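(* For every $\epsilon>0$ there exists $D_1(\epsilon)$ such that the following holds. If $H$ is a graph of average degree $d>D_1(\epsilon)$, and $G$ is a graph of density at least $p+\epsilon$, where $\epsilon<p<1-\epsilon$, $|G|\geq |H|\sqrt{\log_{1/(1-p)} d}$ and $\kappa(G)\geq \epsilon|G|$, then $G\succ H$.
   Context: Graphs are finite and simple. $|G|$ denotes the number of vertices of a graph $G$, $e(G)$ its number of edges, $\kappa(G)$ its (vertex) connectivity, and the density of $G$ is $e(G)/\binom{|G|}{2}$. $\log_b$ denotes the logarithm to base $b$. A graph $H$ is a minor of $G$, written $G\succ H$, if there exist non-empty disjoint subsets $U_v\subset V(G)$, $v\in V(H)$, such that each induced subgraph $G[U_v]$ is connected, and there is an edge in $G$ between $U_v$ and $U_w$ whenever $vw$ is an edge of $H$. *)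

(* Defs.v *)
From mathcomp Require Import all_boot all_order all_algebra.
From mathcomp Require Import reals exp.
Set Implicit Arguments.
Unset Strict Implicit.
Unset Printing Implicit Defensive.

Import GRing.Theory Num.Theory.
Local Open Scope ring_scope.

Record sgraph := SGraph {
  vertex :> finType;
  adj : rel vertex;
  adj_sym : symmetric adj;
  adj_irr : irreflexive adj
}.

Arguments adj {s} x y.

Section Graphs.
Variable G : sgraph.

Definition edges : {set {set G}} :=
  [set e : {set G} | [exists x, exists y, adj x y && (e == [set x; y])]].

Section Induced.
Variable A : {set G}.

Definition induced_adj : rel {x : G | x \in A} :=
  [rel x y | adj (val x) (val y)].

Lemma induced_adj_sym : symmetric induced_adj.
Proof. by move=> x y; apply: adj_sym. Qed.

Lemma induced_adj_irr : irreflexive induced_adj.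
Proof. by move=> x; apply: adj_irr. Qed.

Definition induced : sgraph := SGraph induced_adj_sym induced_adj_irr.

End Induced.
End Graphs.

(* The graph without vertices counts as connected; in [k_connected] and [minor]
   below this predicate is only ever used on nonempty graphs. *)
Definition connected (G : sgraph) : bool :=
  [forall x : G, forall y : G, connect adj x y].

Definition k_connected (G : sgraph) (k : nat) : bool :=
  (k < #|G|)%N &&
  [forall X : {set G}, (#|X| < k)%N ==> connected (induced (~: X))].

(* The complete graph on n >= 1 vertices has connectivity n - 1. *)
Definition kappa (G : sgraph) : nat :=
  \max_(k < #|G| | k_connected G k) k.

Definition minor (G H : sgraph) : Prop :=
  exists U : H -> {set G},
    [/\ forall v : H, U v != set0,
        forall v w : H, v != w -> [disjoint U v & U w],
        forall v : H, connected (induced (U v))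
      & forall v w : H, adj v w ->
          exists x y : G, [/\ x \in U v, y \in U w & adj x y]].

(* Since x / 0 = 0, a graph without vertices has average degree 0 and a graph
   with at most one vertex has density 0. *)
Definition avg_degree (R : realType) (G : sgraph) : R := (2 * #|edges G|)%:R / #|G|%:R.

Definition density (R : realType) (G : sgraph) : R := #|edges G|%:R / 'C(#|G|, 2)%:R.

Definition logb (R : realType) (b x : R) : R := ln x / ln b.

Arguments avg_degree {R} G.
Arguments density {R} G.

(* Main.v *)
Require Import Defs.
From mathcomp Require Import all_boot all_order all_algebra all_fingroup.
From mathcomp Require Import reals sequences exp.
From mathcomp Require Import zify ring lra.
Set Implicit Arguments.
Unset Strict Implicit.
Unset Printing Implicit Defensive.

Import Order.TTheory GRing.Theory Num.Theory.

(* Let n = |G|, lambda = sqrt (log_{1/(1-p)} d) and l = (1 - 4a) lambda for a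
   small a. Since kappa(G) >= eps n, any two vertices are joined by linearly many
   disjoint paths of bounded length, so a small random set A of vertices still
   contains linearly many of them for every pair of vertices. Outside A, sort the
   vertices by degree, cut them into l blocks of size m and form m parts of size l
   at random, each part a transversal of the blocks. For all but few parts the
   number of vertices of the j-th block missed by the part is at most
   l^O(1) mu_j^l m, where mu_j is the largest proportion of non-neighbours of a
   vertex of block j. By AM-GM two such balanced parts span no edge with
   probability at most l^O(l) (mean of mu)^(l^2), and since the blocks are sorted
   the mean of mu is at most 1 - p - eps/2 + 1/l. This beats 1/d by a factor
   exp(-c l^2), so the vertices of H can be assigned to balanced parts in such a
   way that at most |H| edges of H are not realised. Every part is dominated by
   o(l) vertices of A, and joining these dominating vertices, and repairing the
   unrealised edges, takes o(l) |H| = o(n) short paths, all found inside A. *)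

(** * Short links in highly connected graphs *)

Section Linking.
Variable G : sgraph.
Implicit Types (x y z : G) (A B P X : {set G}).

(** Adjacency inside [A] is kept as a relation on [G] itself, so that paths in different vertex sets
    can be compared without passing through the subtypes of [induced]. *)
Definition inside A : rel G := [rel x y | [&& x \in A, y \in A & adj x y]].

Definition nbh x : {set G} := [set y | adj x y].

Lemma inside_connect_sym A : connect_sym (inside A).
Proof.
by apply: sym_connect_sym => x y; rewrite /inside /= adj_sym andbCA.
Qed.

Lemma connect_inside_sub A B x y :
  A \subset B -> connect (inside A) x y -> connect (inside B) x y.
Proof.
move=> /subsetP sAB; apply: connect_sub => u v /and3P[uA vA uv].
by apply: connect1; rewrite /inside /= !sAB.
Qed.

Lemma connected_inducedP A :
  reflect {in A &, forall x y, connect (inside A) x y} (connected (induced A)).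
Proof.
apply: (iffP forallP) => [conA x y xA yA | conA [x xA]]; last first.
  apply/forallP => -[y yA].
  have /connectP[p] := conA x y xA yA.
  elim: p x xA => [|z p IHp] x xA /=.
    move=> _ eq_yx; subst y; rewrite (bool_irrelevance yA xA).
    exact: connect0.
  case/andP=> /and3P[_ zA xz] pth lst.
  apply: connect_trans (IHp z zA pth lst).
  exact: connect1.
have /forallP/(_ (exist _ y yA)) := conA (exist _ x xA).
case/connectP => p.
elim: p x xA => [|[z zA] p IHp] x xA /=; first by move=> _ [->]; apply: connect0.
case/andP=> xz pth lst.
apply: connect_trans (IHp z zA pth lst).
by apply: connect1; rewrite /inside /= xA zA.
Qed.

Definition rooted x A := {in A, forall y, connect (inside A) x y}.

Lemma rooted1 x : rooted x (x |: set0).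
Proof. by move=> y; rewrite setU0 inE => /eqP ->; apply: connect0. Qed.

Lemma rooted_connected x A : rooted x A -> connected (induced A).
Proof.
move=> rA; apply/connected_inducedP => y z yA zA.
by apply: connect_trans (rA z zA); rewrite inside_connect_sym; apply: rA.
Qed.

Lemma connect_exit A B x y :
  connect (inside A) x y -> x \in B -> y \notin B ->
  exists u v, [/\ u \in B, v \notin B, v \in A & adj u v].
Proof.
case/connectP=> p; elim: p x => [|z p IHp] x /=.
  by move=> _ -> ->.
case/andP=> /and3P[xA zA xz] pth lst xB yB.
have [zB | zB] := boolP (z \in B); first exact: IHp pth lst zB yB.
by exists x, z.
Qed.

(** [P] stands for the interior of an [x]-[y] path. Only connectedness matters later, so the order
    along the path is forgotten and [y] is merely adjacent to the rooted set. *)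
Definition link x y P := rooted x (x |: P) /\ exists2 z, z \in x |: P & adj z y.

Section Ball.
Variables (X : {set G}) (x : G).

(** The distance ball of radius [k] about [x] once the vertices of [X] are deleted. *)
Definition ball (k : nat) : {set G} :=
  iter k (fun B => B :|: [set y in ~: X | [exists z in B, adj z y]]) [set x].

Lemma ballS k :
  ball k.+1 = ball k :|: [set y in ~: X | [exists z in ball k, adj z y]].
Proof. by []. Qed.

Lemma ball_mono k : ball k \subset ball k.+1.
Proof. by rewrite ballS subsetUl. Qed.

Lemma ball_center k : x \in ball k.
Proof.
by elim: k => [|k IHk]; [rewrite inE | apply: (subsetP (ball_mono k))].
Qed.

Lemma ball_adj k y z : z \in ball k -> y \notin X -> adj z y -> y \in ball k.+1.
Proof.
move=> zB yX zy; rewrite ballS !inE yX.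
by apply/orP; right; apply/exists_inP; exists z.
Qed.

(** Follow breadth-first predecessors back to the centre: each layer contributes at most one new
    vertex to [P]. *)
Lemma ball_rooted k v : v \in ball k ->
  exists P, [/\ P \subset ball k :\: X, x \notin P, #|P| <= k,
                rooted x (x |: P) & v \in x |: P].
Proof.
elim: k v => [|k IHk] v.
  rewrite inE => /eqP ->; exists set0.
  by rewrite sub0set cards0 inE !inE eqxx; split=> //; apply: rooted1.
have [vB _|vB] := boolP (v \in ball k).
  have [P [sP xP cP rP vP]] := IHk v vB; exists P; split=> //; last exact: leqW.
  by apply: subset_trans sP (setSD _ (ball_mono k)).
rewrite ballS inE (negPf vB) /= => vS.
have vS' := vS; move: vS; rewrite !inE => /andP[vX /exists_inP[z zB zv]].
have [P [sP xP cP rP zP]] := IHk z zB; exists (v |: P); split.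
- rewrite subUset sub1set !inE vX (negPf vB) /=; apply/andP; split.
    by apply/exists_inP; exists z.
  by apply: subset_trans sP (setSD _ _); rewrite subsetUl.
- rewrite !inE negb_or xP andbT; apply: contraNneq vB => <-.
  exact: ball_center.
- by rewrite cardsU1; have := leq_b1 (v \notin P); lia.
- have sub : x |: P \subset x |: (v |: P).
    by apply/subsetP => w; rewrite !inE => /orP[] ->; rewrite ?orbT.
  have sz : connect (inside (x |: (v |: P))) x z.
    exact: connect_inside_sub sub (rP z zP).
  move=> w; rewrite !inE => /or3P[/eqP->|/eqP->|wP]; first exact: connect0.
    apply: connect_trans sz (connect1 _); rewrite /inside /= zv andbT.
    by rewrite (subsetP sub) // !inE eqxx orbT.
  apply: connect_inside_sub sub (rP w _); by rewrite !inE wP orbT.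
- by rewrite !inE eqxx orbT.
Qed.

Hypothesis xX : x \notin X.
Variable D : nat.
Hypothesis deg : forall z, D + #|X| <= #|nbh z|.
Hypothesis conX : connected (induced (~: X)).

Lemma card_nbhD z : D <= #|nbh z :\: X|.
Proof.
have := deg z; have := cardsID X (nbh z).
have : #|nbh z :&: X| <= #|X| by apply/subset_leq_card/subsetIr.
lia.
Qed.

(* A vertex at distance exactly [3 i + 4] has all its neighbours outside
   [ball (3 i + 2)] and inside [ball (3 i + 5)]. *)
Lemma ball_growth y i : y \notin X -> y \notin ball (3 * i + 2) ->
  i.+1 * D <= #|ball (3 * i + 2)|.
Proof.
move=> yX; elim: i => [|i IHi] yB.
  rewrite muln0 add0n mul1n; apply: leq_trans (card_nbhD x) (subset_leq_card _).
  apply/subsetP=> z; rewrite in_setD inE => /andP[zX xz].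
  apply: (subsetP (ball_mono 1)); exact: ball_adj (ball_center 0) zX xz.
have e : 3 * i.+1 + 2 = (3 * i + 2).+3 by lia.
rewrite e in yB *; set k := 3 * i + 2 in IHi yB *.
have b2 := ball_mono k.+2; have b1 := ball_mono k.+1; have b0 := ball_mono k.
have yB2 : y \notin ball k.+2 by apply: contra yB; apply: (subsetP b2).
have yB1 : y \notin ball k.+1 by apply: contra yB2; apply: (subsetP b1).
have yB0 : y \notin ball k by apply: contra yB1; apply: (subsetP b0).
have conxy : connect (inside (~: X)) x y.
  by apply: (connected_inducedP _ conX); rewrite inE.
have [u [v [uB vB]]] := connect_exit conxy (ball_center k.+1) yB1.
rewrite inE => vX uv.
have vB2 : v \in ball k.+2 by exact: ball_adj uB vX uv.
have dis : [disjoint ball k & nbh v :\: X].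
  rewrite -setI_eq0; apply/eqP/setP=> w; rewrite !inE.
  apply/negP => /andP[wB /andP[wX vw]]; case/negP: vB.
  by apply: ball_adj wB vX _; rewrite adj_sym.
have sub : ball k :|: (nbh v :\: X) \subset ball k.+3.
  rewrite subUset; apply/andP; split.
    exact: subset_trans (subset_trans b0 b1) b2.
  by apply/subsetP=> w; rewrite in_setD inE => /andP[wX vw]; apply: ball_adj vB2 wX vw.
move: dis; rewrite -(leq_card_setU (ball k) (nbh v :\: X)).2 => /eqP cU.
rewrite mulSn addnC; apply: leq_trans (subset_leq_card sub).
by rewrite cU; apply: leq_add; [apply: IHi | apply: card_nbhD].
Qed.

(** If [y] were outside the ball of radius [3 * i + 2], that ball would have at least [i.+1 * D]
    vertices by [ball_growth], more than [G] has. *)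
Lemma short_link y i : y \notin X -> x != y -> #|G| < i.+1 * D ->
  exists P, [/\ [disjoint P & X], x \notin P, y \notin P,
                #|P| <= 3 * i + 1 & link x y P].
Proof.
move=> yX xy big.
have yB : y \in ball (3 * i + 2).
  apply: contraTT big => yB; rewrite -leqNgt.
  exact: leq_trans (ball_growth yX yB) (max_card _).
(* The least radius reaching [y] is used, so that [y] lies outside the previous ball, which contains
   [P]; the interior is also one shorter than the distance. *)
have exk : exists k, y \in ball k by exists (3 * i + 2).
have [[|k] yBk kmin] := ex_minnP exk.
  by move: yBk xy; rewrite inE => /eqP ->; rewrite eqxx.
have yk : y \notin ball k by apply/negP => /kmin; rewrite ltnn.
move: yBk; rewrite ballS inE (negPf yk) !inE yX /= => /exists_inP[z zB zy].
have [P [sP xP cP rP zP]] := ball_rooted zB.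
have le_k := kmin _ yB.
exists P; split=> //.
- rewrite -setI_eq0 -subset0; apply/subsetP => w; rewrite !inE => /andP[wP].
  by have := subsetP sP w wP; rewrite inE => /andP[/negPf->].
- by apply: contra yk => /(subsetP sP); rewrite inE => /andP[].
- by move: cP le_k; clear; lia.
- by split=> //; exists z.
Qed.

End Ball.

(** Links are collected greedily. While those found cover at most [k - D] vertices, deleting them
    leaves a connected graph of minimum degree at least [D], in which [short_link] finds another one
    disjoint from all of them. *)
Lemma link_family (k D i : nat) x y :
  (forall z, k <= #|nbh z|) ->
  (forall X, #|X| < k -> connected (induced (~: X))) ->
  D <= k -> #|G| < i.+1 * D -> x != y -> ~~ adj x y ->
  exists F : {set {set G}},
    [/\ trivIset F, {in F, forall P, #|P| <= 3 * i + 1},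
        {in F, forall P, link x y P} & k - D < #|F| * (3 * i + 1)].
Proof.
move=> degk conk Dk big xy nxy.
pose ok (F : {set {set G}}) := trivIset F /\
  {in F, forall P, [/\ #|P| <= 3 * i + 1, link x y P, x \notin P & y \notin P]}.
suff [F [[tF okF] cF]] : exists F, ok F /\ k - D < #|F| * (3 * i + 1).
  by exists F; split=> // P /okF[].
suff step j : exists F, ok F /\
    (k - D < #|F| * (3 * i + 1) \/ j <= #|F|).
  have [F [okF [|]]] := step (k - D).+1; first by exists F.
  by exists F; split=> //; nia.
elim: j => [|j [F [[tF okF]]]].
  exists set0; split; last by right.
  split; first by apply/trivIsetP => A B; rewrite inE.
  by move=> P; rewrite inE.
case=> [|jF]; first by exists F; split; [|left].
have [|leF] := ltnP (k - D) (#|F| * (3 * i + 1)); first by exists F; split; [|left].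
have cov : #|cover F| <= k - D.
  apply: leq_trans leF; rewrite -(eqP tF) -sum_nat_const.
  by apply: leq_sum => P /okF[].
have xc : x \notin cover F.
  by apply/negP => /bigcupP[P /okF[_ _ /negP xP]].
have yc : y \notin cover F.
  by apply/negP => /bigcupP[P /okF[_ _ _ /negP yP]].
have D0 : 0 < D by case: D big {Dk leF cov} => //; rewrite muln0.
have [||P [dP xP yP cP lP]] := @short_link (cover F) x xc D _ _ y i yc xy big.
- by move=> z; apply: leq_trans (degk z); lia.
- by apply: conk; lia.
(* Nonadjacency makes the link nonempty; being disjoint from the cover, it is then a new member and
   the family really grows. *)
have P0 : P != set0.
  apply/eqP => P0; case: lP => _ [z]; rewrite P0 setU0 inE => /eqP ->.
  by rewrite (negPf nxy).
have PF : P \notin F.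
  apply/negP => PF; case/set0Pn: P0 => w wP.
  have := disjointFr dP wP; rewrite (_ : w \in cover F) //.
  by apply/bigcupP; exists P.
exists (P |: F); split; last by right; rewrite cardsU1 PF.
split; last by move=> Q /setU1P[->|/okF].
apply/trivIsetP => A B /setU1P[->|AF] /setU1P[->|BF].
- by rewrite eqxx.
- by move=> _; apply: disjointWr dP; apply: bigcup_sup BF.
- by move=> _; rewrite disjoint_sym; apply: disjointWr dP; apply: bigcup_sup AF.
- exact: (trivIsetP tF).
Qed.

(** The maximum defining [kappa] is attained because 0 is always an admissible value. *)
Lemma kappa_connected : 0 < #|G| -> k_connected G (kappa G).
Proof.
move=> G0; rewrite /kappa.
have k0 : k_connected G (Ordinal G0) by rewrite /k_connected G0; apply/forallP.
have P0 : (0 < #|[pred k : 'I_#|G| | k_connected G k]|)%N.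
  by apply/card_gt0P; exists (Ordinal G0).
by have [k kk ->] := eq_bigmax_cond (fun k : 'I_#|G| => k : nat) P0.
Qed.

Lemma k_connected_connected k X :
  k_connected G k -> #|X| < k -> connected (induced (~: X)).
Proof. by case/andP=> _ /forallP/(_ X)/implyP. Qed.

(** Otherwise deleting the neighbours of [x], fewer than [k], would separate [x] from some remaining
    vertex. *)
Lemma k_connected_degree k x : k_connected G k -> k <= #|nbh x|.
Proof.
move=> kG; rewrite leqNgt; apply/negP => lt.
have con := k_connected_connected kG lt.
have kn : k < #|G| by case/andP: kG.
have xN : x \in ~: nbh x by rewrite !inE adj_irr.
have [y yN xy] : exists2 y, y \in ~: nbh x & y != x.
  have : 0 < #|~: nbh x :\ x|.
    have := cardsC (nbh x); have := cardsD1 x (~: nbh x); rewrite xN; lia.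
  by case/card_gt0P => y; rewrite in_setD1 => /andP[]; exists y.
have := connected_inducedP _ con x y xN yN.
case/(connect_exit (B := [set x])); rewrite ?inE // => u [v].
by rewrite !inE => -[/eqP-> _ /negPf->].
Qed.

End Linking.

(** * Assembling a minor from parts and a linking reserve *)

(** Requests are served one by one: [X] together with the sets already chosen never exceeds the
    budget [t]. Outside [A] the choice is empty, which is why disjointness and the size bound hold
    over all of [Q]. *)
Lemma greedy_disjoint (V Q : finType) (good : Q -> {set V} -> Prop) (t L : nat)
    (X : {set V}) (A : {set Q}) :
  (forall q (Y : {set V}), q \in A -> #|Y| <= t ->
     exists P : {set V}, [/\ [disjoint P & Y], #|P| <= L & good q P]) ->
  #|X| + #|A| * L <= t ->
  exists f : Q -> {set V},
    [/\ forall q, [disjoint f q & X],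
        forall q r, q != r -> [disjoint f q & f r],
        forall q, q \in A -> good q (f q)
      & #|\bigcup_q f q| <= #|A| * L].
Proof.
have [n] := ubnP #|A|; elim: n A => // n IHn A leAn.
have [->|[q qA]] := set_0Vmem A.
  move=> _ _; exists (fun=> set0); split.
  - by move=> q; rewrite -setI_eq0 set0I.
  - by move=> q r _; rewrite -setI_eq0 set0I.
  - by move=> q; rewrite inE.
  - by rewrite big1 ?cards0.
move=> pickA; have cA := cardsD1 q A; rewrite qA in cA; rewrite cA => le_t.
have [|||f [fX ff fA cf]] := IHn (A :\ q).
- by lia.
- by move=> r Y /setD1P[_ rA]; apply: pickA.
- by nia.
have [|P [PX cP gP]] := pickA q (X :|: \bigcup_r f r) qA.
  by rewrite (leq_trans (leq_card_setU _ _).1) //; nia.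
have dP r : [disjoint P & f r].
  by apply: disjointWr PX; rewrite subsetU // (bigcup_sup r) ?orbT.
exists (fun r => if r == q then P else f r); split.
- move=> r; case: eqP => // _.
  by apply: disjointWr PX; rewrite subsetU ?subxx.
- move=> r r' rr'; have [erq|_] := eqVneq r q; have [er'q|_] := eqVneq r' q => //.
  - by rewrite erq er'q eqxx in rr'.
  - by rewrite disjoint_sym.
  - exact: ff.
- by move=> r rA; case: eqP => [-> //|/eqP rq]; apply: fA; rewrite !inE rq.
- apply: (@leq_trans #|P :|: \bigcup_r f r|).
    apply/subset_leq_card/bigcupsP => r _; case: eqP => _; first exact: subsetUl.
    by rewrite subsetU // (bigcup_sup r) ?orbT.
  by rewrite (leq_trans (leq_card_setU _ _).1) //; nia.
Qed.

Section Assembly.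
Variables G H : sgraph.

Lemma rooted_grow (x : G) (A B : {set G}) :
  rooted x A -> A \subset B ->
  (forall y, y \in B -> y \notin A ->
     exists C : {set G}, [/\ rooted x C, C \subset B & exists2 z, z \in C & adj z y]) ->
  rooted x B.
Proof.
move=> rA AB grow y yB; have [yA|yA] := boolP (y \in A).
  exact: connect_inside_sub AB (rA y yA).
have [C [rC CB [z zC zy]]] := grow y yB yA.
apply: connect_trans (connect_inside_sub CB (rC z zC)) (connect1 _).
by rewrite /inside /= (subsetP CB) // yB.
Qed.

(** Three greedy rounds inside [R]: a set [S h] dominating [U h], links from a root of [S h] to the
    members of [S h], and for each pair in [B] a link between the two roots. The three terms of the
    last hypothesis pay for these rounds. *)
Lemma minor_of_parts (R : {set G}) (t L s : nat) (U : H -> {set G})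
    (B : rel H) :
  (forall (x y : G) (X : {set G}), #|X| <= t ->
     exists P : {set G}, [/\ P \subset R, [disjoint P & X], #|P| <= L,
        rooted x (x |: P) & x != y -> exists2 z, z \in x |: P & adj z y]) ->
  (forall (h : H) (X : {set G}), #|X| <= t ->
     exists S : {set G}, [/\ S \subset R, [disjoint S & X], #|S| <= s &
        forall u, u \in U h -> exists2 z, z \in S & adj z u]) ->
  (forall h, U h != set0) -> (forall h, [disjoint U h & R]) ->
  (forall h k, h != k -> [disjoint U h & U k]) ->
  (forall h k, adj h k -> ~~ B h k ->
     exists x y, [/\ x \in U h, y \in U k & adj x y]) ->
  #|H| * s + #|H| * s * L + #|[set e : H * H | B e.1 e.2]| * L <= t ->
  minor G H.
Proof.
move=> linkR domR U0 UR UU UB le_t.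
have [||S [_ SS goodS cS]] := @greedy_disjoint G H
    (fun h S => [/\ S \subset R, #|S| <= s &
                    forall u, u \in U h -> exists2 z, z \in S & adj z u])
    t s set0 setT.
- by move=> h X _ leX; have [S [? ? ? ?]] := domR h X leX; exists S.
- by rewrite cards0 cardsT; lia.
rewrite cardsT in cS.
have root_ex h : exists z, z \in S h.
  have [_ _ dom] := goodS h (in_setT h).
  by have /set0Pn[u /dom[z zS _]] := U0 h; exists z.
pose z0 h := xchoose (root_ex h).
have z0S h : z0 h \in S h by apply: xchooseP.
have cSsum : #|[set q : H * G | q.2 \in S q.1]| <= #|H| * s.
  rewrite -sum1dep_card -(pair_big_dep xpredT (fun h z => z \in S h) (fun _ _ => 1)) /=.
  rewrite -sum_nat_const; apply: leq_sum => h _; rewrite sum1_card.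
  by have [] := goodS h (in_setT h).
have [||P [PS PP goodP cP]] := @greedy_disjoint G (H * G)%type
    (fun q P => [/\ P \subset R, rooted (z0 q.1) (z0 q.1 |: P) &
       z0 q.1 != q.2 -> exists2 z, z \in z0 q.1 |: P & adj z q.2])
    t L (\bigcup_h S h) [set q : H * G | q.2 \in S q.1].
- move=> q X _ leX; have [P [? ? ? ? ?]] := linkR (z0 q.1) q.2 X leX.
  by exists P.
- apply: leq_trans le_t; apply: leq_trans (leq_addr _ _).
  by apply: leq_add cS _; rewrite leq_mul2r cSsum orbT.
have [||Q [QX QQ goodQ _]] := @greedy_disjoint G (H * H)%type
    (fun q P => [/\ P \subset R, rooted (z0 q.1) (z0 q.1 |: P) &
       z0 q.1 != z0 q.2 -> exists2 z, z \in z0 q.1 |: P & adj z (z0 q.2)])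
    t L ((\bigcup_h S h) :|: \bigcup_q P q) [set q : H * H | B q.1 q.2].
- move=> q X _ leX; have [P' [? ? ? ? ?]] := linkR (z0 q.1) (z0 q.2) X leX.
  by exists P'.
- apply: leq_trans le_t; rewrite leq_add2r.
  apply: leq_trans (leq_card_setU _ _).1 _; apply: leq_add cS _.
  by apply: leq_trans cP _; rewrite leq_mul2r cSsum orbT.
have absurd (C D : {set G}) w : [disjoint C & D] -> w \in C -> w \in D -> False.
  by move=> CD wC; rewrite (disjointFr CD wC).
have SR h : S h \subset R by have [] := goodS h (in_setT h).
pose Wp h := \bigcup_(z in S h) P (h, z).
pose Wq h := \bigcup_(k | B h k) Q (h, k).
(* The branch set is connected in layers: the links hang on the root, each vertex of [S h] on its
   link, and each vertex of [U h], which may itself span no edges, on a dominating vertex. *)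
pose core h := z0 h |: (Wp h :|: Wq h).
pose W h := U h :|: (S h :|: core h).
have z0core h : z0 h \in core h by rewrite !inE eqxx.
have coreW h : core h \subset S h :|: core h by apply: subsetUr.
have Pcore h z : z \in S h -> z0 h |: P (h, z) \subset core h.
  by move=> zS; apply: setUS; rewrite subsetU // (bigcup_sup z).
have Qcore h k : B h k -> z0 h |: Q (h, k) \subset core h.
  by move=> Bhk; apply: setUS; rewrite subsetU // (bigcup_sup k) ?orbT.
have goodP' h z : z \in S h ->
    [/\ P (h, z) \subset R, rooted (z0 h) (z0 h |: P (h, z)) &
       z0 h != z -> exists2 z', z' \in z0 h |: P (h, z) & adj z' z].
  by move=> zS; apply: (goodP (h, z)); rewrite inE.
have goodQ' h k : B h k ->
    [/\ Q (h, k) \subset R, rooted (z0 h) (z0 h |: Q (h, k)) &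
       z0 h != z0 k -> exists2 z', z' \in z0 h |: Q (h, k) & adj z' (z0 k)].
  by move=> Bhk; apply: (goodQ (h, k)); rewrite inE.
have rcore h : rooted (z0 h) (core h).
  move=> y; rewrite in_setU1 => /predU1P[->|]; first exact: connect0.
  case/setUP => /bigcupP[z zS yz].
    have [_ rt _] := goodP' h z zS; apply: connect_inside_sub (Pcore h z zS) (rt y _).
    by rewrite in_setU1 yz orbT.
  have [_ rt _] := goodQ' h z zS; apply: connect_inside_sub (Qcore h z zS) (rt y _).
  by rewrite in_setU1 yz orbT.
have rS h : rooted (z0 h) (S h :|: core h).
  apply: rooted_grow (rcore h) (coreW h) _ => y; rewrite inE => /orP[yS|->//] yc.
  have [_ rt ex] := goodP' h y yS; exists (z0 h |: P (h, y)); split=> //.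
    exact: subset_trans (Pcore h y yS) (coreW h).
  by apply: ex; apply: contraNneq yc => <-.
have rW h : rooted (z0 h) (W h).
  apply: rooted_grow (rS h) (subsetUr _ _) _ => y; rewrite [y \in W h]inE => /orP[yU|->//] _.
  exists (S h :|: core h); split=> //; first exact: subsetUr.
  have [_ _ /(_ y yU)[z zS zy]] := goodS h (in_setT h).
  by exists z => //; rewrite inE zS.
have TP h w : w \in S h :|: core h ->
   [\/ w \in S h, exists2 z, z \in S h & w \in P (h, z)
     | exists2 k, B h k & w \in Q (h, k)].
  rewrite 2!inE => /orP[|/orP[/set1P->|/setUP[/bigcupP[z zS wz]|/bigcupP[k hk wk]]]].
  - by constructor 1.
  - by constructor 1.
  - by constructor 2; exists z.
  - by constructor 3; exists k.
have TR h w : w \in S h :|: core h -> w \in R.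
  case/TP => [|[z /(goodP' h)[PR _ _]]|[k /(goodQ' h)[QR _ _]]]; exact/subsetP.
have notP h z w : w \in S h -> forall k, w \in P (k, z) -> False.
  move=> wS k wP; apply: absurd (PS (k, z)) wP _; by apply/bigcupP; exists h.
have notQ h q w : w \in S h -> w \in Q q -> False.
  move=> wS wQ; apply: absurd (QX q) wQ _; rewrite inE; apply/orP; left.
  by apply/bigcupP; exists h.
have notPQ p q w : w \in P p -> w \in Q q -> False.
  move=> wP wQ; apply: absurd (QX q) wQ _; rewrite inE; apply/orP; right.
  by apply/bigcupP; exists p.
exists W; split.
- by move=> h; apply/set0Pn; exists (z0 h); rewrite !inE z0S orbT.
- move=> h k hk; rewrite -setI_eq0; apply/eqP/setP => w; rewrite in_set0.
  have pairN (z z' : G) : (h, z) != (k, z') by rewrite xpair_eqE (negPf hk).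
  have pairN' (z z' : H) : (h, z) != (k, z') by rewrite xpair_eqE (negPf hk).
  apply/negP => /setIP[/setUP[wh|wh] /setUP[wk|wk]].
  + exact: absurd (UU h k hk) wh wk.
  + exact: absurd (UR h) wh (TR _ _ wk).
  + exact: absurd (UR k) wk (TR _ _ wh).
  case: (TP _ _ wh) (TP _ _ wk) => [w1|[z1 _ w1]|[k1 _ w1]] [w2|[z2 _ w2]|[k2 _ w2]].
  + exact: absurd (SS h k hk) w1 w2.
  + exact: notP w1 _ w2.
  + exact: notQ w1 w2.
  + exact: notP w2 _ w1.
  + exact: absurd (PP _ _ (pairN z1 z2)) w1 w2.
  + exact: notPQ w1 w2.
  + exact: notQ w2 w1.
  + exact: notPQ w2 w1.
  + exact: absurd (QQ _ _ (pairN' k1 k2)) w1 w2.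
- by move=> h; apply: rooted_connected (rW h).
(* Outside [B] the parts themselves provide the edge; inside [B] it leads from the link [Q (h, k)]
   or the root of [h] to the root of [k]. *)
- move=> h k hk; have [Bhk|nB] := boolP (B h k); last first.
    have [x [y [xU yU xy]]] := UB h k hk nB.
    by exists x, y; rewrite !inE xU yU.
  have nhk : h != k by apply: contraTneq hk => ->; rewrite adj_irr.
  have nz : z0 h != z0 k.
    apply/eqP => e; apply: absurd (SS h k nhk) (z0S h) _; by rewrite e.
  have [_ _ /(_ nz)[x xQ xz]] := goodQ' h k Bhk.
  exists x, (z0 k); split=> //; last by rewrite !inE z0S orbT.
  apply: (subsetP (subsetUr (U h) _)); apply: (subsetP (coreW h)).
  exact: subsetP (Qcore h k Bhk) x xQ.
Qed.

End Assembly.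

Local Open Scope ring_scope.

(** * Greedy domination *)

Section Domination.
Variables (R : realFieldType) (G : sgraph).

(** Double counting of the edges between [U] and [Y]: there are at least [#|U| * T] of them, shared
    among at most [#|G|] vertices of [Y]. *)
Lemma averaging_neighbour (Y U : {set G}) (T : nat) : (0 < T)%N -> U != set0 ->
  (forall u, u \in U -> T <= #|nbh u :&: Y|)%N ->
  exists2 r, r \in Y & (#|U| * T <= #|G| * #|U :&: nbh r|)%N.
Proof.
move=> T0 U0 deg.
have [Y0|/set0Pn[y yY]] := eqVneq Y set0.
  by case/set0Pn: U0 => u /deg; rewrite Y0 setI0 cards0; lia.
have dcount : (\sum_(r in Y) #|U :&: nbh r| = \sum_(u in U) #|nbh u :&: Y|)%N.
  under eq_bigr do rewrite -sum1_card big_mkcond /=.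
  rewrite exchange_big /= [RHS]big_mkcond /=; apply: eq_bigr => u _.
  rewrite -sum1_card; case: (boolP (u \in U)) => uU; last first.
    by rewrite big1 // => r _; rewrite inE (negPf uU).
  rewrite big_mkcond [RHS]big_mkcond; apply: eq_bigr => r _.
  by rewrite !inE uU adj_sym andbC; case: (r \in Y); rewrite ?andbF.
have [/existsP[r /andP[rY le]]|none] :=
  boolP [exists r in Y, #|U| * T <= #|G| * #|U :&: nbh r|]%N; first by exists r.
have lt r : r \in Y -> (#|G| * #|U :&: nbh r| < #|U| * T)%N.
  move=> rY; rewrite ltnNge; apply: contra none => le.
  by apply/existsP; exists r; rewrite rY.
have : (\sum_(r in Y) #|G| * #|U :&: nbh r| < \sum_(r in Y) #|U| * T)%N.
  rewrite (bigD1 y) //= [ltnRHS](bigD1 y) //= -addSn; apply: leq_add; first exact: lt.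
  by apply: leq_sum => r /andP[rY _]; apply/ltnW/lt.
rewrite -big_distrr /= dcount sum_nat_const ltnNge; case/negP.
by apply: leq_mul (max_card _) _; rewrite -sum_nat_const; apply: leq_sum.
Qed.

(** Each vertex chosen by averaging shrinks the undominated set by a factor [1 - c]; after [s]
    choices fewer than one vertex is left. *)
Lemma dominating_set (Y U : {set G}) (T s : nat) (c : R) : 0 < c -> c <= 1 ->
  c * #|G|%:R <= T%:R -> (0 < T)%N ->
  (forall u, u \in U -> T <= #|nbh u :&: Y|)%N ->
  #|U|%:R * (1 - c) ^+ s < 1 ->
  exists S : {set G}, [/\ S \subset Y, (#|S| <= s)%N &
     forall u, u \in U -> exists2 z, z \in S & adj z u].
Proof.
move=> c0 c1 cT T0; elim: s U => [|s IHs] U deg lt1.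
  move: lt1; rewrite expr0 mulr1 ltrn1 ltnS leqn0 cards_eq0 => /eqP ->.
  by exists set0; rewrite sub0set cards0; split=> // u; rewrite inE.
have [->|U0] := eqVneq U set0.
  by exists set0; rewrite sub0set cards0; split=> // u; rewrite inE.
have [r rY avg] := averaging_neighbour T0 U0 deg.
have [||S [SY cS dom]] := IHs (U :\: nbh r).
- by move=> u /setDP[uU _]; apply: deg.
- apply: le_lt_trans lt1; rewrite exprS mulrA; apply: ler_wpM2r.
    by rewrite exprn_ge0; lra.
  have G0 : 0 < #|G|%:R :> R by rewrite ltr0n; apply/card_gt0P; exists r.
  have := cardsID (nbh r) U; move/(congr1 (fun n => n%:R : R)); rewrite natrD.
  move: avg; rewrite -(ler_nat R) !natrM => avg e.
  suff : #|U|%:R * c <= #|U :&: nbh r|%:R :> R by lra.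
  rewrite -(ler_pM2l G0); apply: le_trans avg.
  by rewrite mulrCA; apply: ler_wpM2l; rewrite ?ler0n // mulrC.
exists (r |: S); split.
- by rewrite subUset sub1set rY.
- by rewrite cardsU1; have := leq_b1 (r \notin S); lia.
- move=> u uU; have [ru|nru] := boolP (adj r u); first by exists r; rewrite ?setU11.
  by have [|z zS zu] := dom u; [rewrite !inE nru | exists z; rewrite // setU1r].
Qed.

End Domination.

(** * Random linking reserve *)

Section MultiAffine.
Variables (R : realFieldType) (V : finType).
Implicit Types (f : {ffun V -> R}).

Definition upd f (v : V) (t : R) : {ffun V -> R} :=
  [ffun w => if w == v then t else f w].

Definition affine_in (Phi : {ffun V -> R} -> R) (v : V) := forall f t,
  Phi (upd f v t) = (1 - t) * Phi (upd f v 0) + t * Phi (upd f v 1).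

Lemma upd_id f v : upd f v (f v) = f.
Proof. by apply/ffunP => w; rewrite ffunE; case: eqP => // ->. Qed.

(* The method of conditional expectations. *)
Lemma multi_affine_le (Phi : {ffun V -> R} -> R) f :
  (forall v, affine_in Phi v) -> (forall v, 0 <= f v <= 1) ->
  exists A : {set V}, Phi [ffun v => (v \in A)%:R] <= Phi f.
Proof.
move=> aff f01.
suff [g [_ g01 gle]] : exists g : {ffun V -> R},
    [/\ forall v, 0 <= g v <= 1,
        {in enum V, forall v, g v = 0 \/ g v = 1} & Phi g <= Phi f].
  exists [set v | g v == 1]; rewrite (_ : [ffun v => _] = g) //.
  apply/ffunP => v; rewrite ffunE inE.
  by have [->|->] := g01 v (mem_enum V v); rewrite ?eqxx // eq_sym oner_eq0.
elim: (enum V) => [|v s [g [gI g01 gle]]]; first by exists f.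
have /andP[gv0 gv1] := gI v.
(* The value at [g v] is a convex combination of the values at 0 and 1, so one of the endpoints does
   not increase [Phi]. *)
have [b bP] : exists b : bool, Phi (upd g v b%:R) <= Phi g.
  have := aff v g (g v); rewrite upd_id => e.
  have [le|lt] := lerP (Phi (upd g v 0)) (Phi g); first by exists false.
  exists true; move: e lt gv0 gv1; rewrite /= mulr1n.
  set a := Phi (upd g v 0); set c := Phi (upd g v 1); set t := g v.
  move=> e lt t0 t1; rewrite e; rewrite e in lt.
  suff : 0 <= (1 - t) * (a - c) by lra.
  apply: mulr_ge0; first by lra.
  by rewrite leNgt; apply/negP => ac; nra.
exists (upd g v b%:R); split; last exact: le_trans gle.
- by move=> w; rewrite ffunE; case: eqP => // _; case: b {bP}; rewrite ?lexx ler01.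
- move=> w; rewrite ffunE inE; case: eqP => [_ _|_ /= /g01 //].
  by case: b {bP}; [right | left].
Qed.

Lemma affine_sum (I : finType) (r : seq I) (Q : pred I) (F : I -> {ffun V -> R} -> R) v :
  (forall i, affine_in (F i) v) ->
  affine_in (fun f => \sum_(i <- r | Q i) F i f) v.
Proof.
move=> aff f t; rewrite !mulr_sumr -big_split /=.
by apply: eq_bigr => i _; rewrite aff.
Qed.

(* Since [v] lies in at most one member of [F], only one factor depends on [f v]. *)
Lemma affine_prod (F : {set {set V}}) (c : R) v : trivIset F ->
  affine_in (fun f => \prod_(P in F) (1 - c * \prod_(w in P) f w)) v.
Proof.
move=> tF f t.
have eqn (P : {set V}) u1 u2 : v \notin P ->
    \prod_(w in P) upd f v u1 w = \prod_(w in P) upd f v u2 w.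
  move=> vP; apply: eq_bigr => w wP; rewrite !ffunE.
  by case: eqP => // e; rewrite -e wP in vP.
have [P /andP[PF vP]|noP] := pickP [pred P in F | v \in P]; last first.
  have e u : \prod_(P in F) (1 - c * \prod_(w in P) upd f v u w) =
             \prod_(P in F) (1 - c * \prod_(w in P) upd f v 0 w).
    apply: eq_bigr => P PF; rewrite (eqn P u 0) //.
    by have := noP P; rewrite inE PF /= => ->.
  by rewrite (e t) (e 1); ring.
have e u : \prod_(P in F) (1 - c * \prod_(w in P) upd f v u w) =
   (1 - c * (u * \prod_(w in P | w != v) f w)) *
   \prod_(Q in F | Q != P) (1 - c * \prod_(w in Q) upd f v 0 w).
  rewrite (bigD1 P) //=; congr (_ * _).
    rewrite (bigD1 v) //= ffunE eqxx; congr (1 - c * (u * _)).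
    by apply: eq_bigr => w /andP[_ /negPf]; rewrite ffunE => ->.
  apply: eq_bigr => Q /andP[QF QP]; rewrite (eqn Q u 0) //.
  have /trivIsetP/(_ Q P QF PF QP) dQP := tF.
  by apply/negP => vQ; have := disjointFr dQP vQ; rewrite vP.
by rewrite (e t) (e 0) (e 1); ring.
Qed.

Lemma affine_add (Phi Psi : {ffun V -> R} -> R) v :
  affine_in Phi v -> affine_in Psi v -> affine_in (fun f => Phi f + Psi f) v.
Proof. by move=> aPhi aPsi f t; rewrite aPhi aPsi; ring. Qed.

Lemma affine_scale (Phi : {ffun V -> R} -> R) c v :
  affine_in Phi v -> affine_in (fun f => c * Phi f) v.
Proof. by move=> aPhi f t; rewrite aPhi; ring. Qed.

Lemma affine_eval w v : affine_in (fun f => f w) v.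
Proof. by move=> f t; rewrite !ffunE; case: eqP => _; ring. Qed.

(* A random set containing each vertex with probability [q] works: this is the
   first moment method applied to [#|A| / (2 q #|V|)] plus the sum over [i] of
   [2 ^ (t - X_i)], where [X_i] counts the members of [F i] contained in [A]. *)
Lemma random_reserve (I : finType) (F : I -> {set {set V}}) (L M t : nat) (q : R) :
  0 < q -> q <= 1 -> (0 < #|V|)%N ->
  (forall i, trivIset (F i)) -> (forall i P, P \in F i -> (#|P| <= L)%N) ->
  (forall i, M <= #|F i|)%N ->
  #|I|%:R * (2 ^+ t * (1 - 2^-1 * q ^+ L) ^+ M) < 2^-1 ->
  exists A : {set V}, #|A|%:R <= 2 * q * #|V|%:R /\
    forall i, (t < #|[set P in F i | P \subset A]|)%N.
Proof.
move=> q0 q1 V0 tF cF MF small.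
have V0' : 0 < #|V|%:R :> R by rewrite ltr0n.
pose Phi (f : {ffun V -> R}) := (2 * q * #|V|%:R)^-1 * (\sum_(v : V) f v) +
  \sum_(i : I) 2 ^+ t * \prod_(P in F i) (1 - 2^-1 * \prod_(w in P) f w).
pose f0 : {ffun V -> R} := [ffun=> q].
have affPhi v : affine_in Phi v.
  apply: affine_add; first by apply/affine_scale/affine_sum => w; apply: affine_eval.
  by apply: affine_sum => i; apply/affine_scale/affine_prod.
have [v|A leA] := multi_affine_le (f := f0) affPhi; first by rewrite ffunE (ltW q0).
have qL01 k : 0 <= q ^+ k <= 1 by rewrite exprn_ge0 ?(ltW q0) //= exprn_ile1 ?(ltW q0).
have Phi0 : Phi f0 < 1.
  suff : Phi f0 <= 2^-1 + #|I|%:R * (2 ^+ t * (1 - 2^-1 * q ^+ L) ^+ M).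
    by move: small; lra.
  apply: lerD.
    rewrite (eq_bigr (fun=> q)) => [|v _]; last by rewrite ffunE.
    rewrite sumr_const -mulr_natr le_eqVlt; apply/orP; left; apply/eqP.
    by field; rewrite !gt_eqF.
  rewrite mulr_natl -sumr_const; apply: ler_sum => i _.
  apply: ler_wpM2l; first by rewrite exprn_ge0.
  (* At the constant [q] the product is the expectation of [2 ^ (- X_i)]: the members of [F i] are
     disjoint, so their inclusions in the random set are independent. *)
  apply: (@le_trans _ _ ((1 - 2^-1 * q ^+ L) ^+ #|F i|)).
    rewrite -prodr_const; apply: ler_prod => P PF.
    rewrite (eq_bigr (fun=> q)) => [|w _]; last by rewrite ffunE.
    rewrite prodr_const; have := qL01 #|P|.
    have : q ^+ L <= q ^+ #|P| by exact: ler_wiXn2l (ltW q0) q1 _ _ (cF i P PF).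
    lra.
  have qL := qL01 L.
  have x0 : 0 <= 1 - 2^-1 * q ^+ L by lra.
  have x1 : 1 - 2^-1 * q ^+ L <= 1 by lra.
  exact: ler_wiXn2l x0 x1 _ _ (MF i).
have valP (P : {set V}) : \prod_(w in P) [ffun v => (v \in A)%:R : R] w = (P \subset A)%:R.
  have [PA|] := boolP (P \subset A).
    by rewrite big1 // => w wP; rewrite ffunE (subsetP PA).
  case/subsetPn => w wP wA; rewrite (bigD1 w) //= ffunE (negPf wA) mul0r //.
have prodE i : \prod_(P in F i) (1 - 2^-1 * \prod_(w in P) [ffun v => (v \in A)%:R : R] w)
    = 2^-1 ^+ #|[set P in F i | P \subset A]|.
  rewrite -prodr_const (bigID (fun P : {set V} => P \subset A)) /= mulrC big1.
    rewrite mul1r; apply: eq_big => P; first by rewrite !inE.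
    by case/andP=> _ PA; rewrite valP PA /=; lra.
  by move=> P /andP[_ /negPf PA]; rewrite valP PA /=; lra.
have sumE : \sum_(v : V) [ffun v => (v \in A)%:R : R] v = #|A|%:R.
  under eq_bigr do rewrite ffunE.
  by rewrite -natr_sum -sum1_card [in RHS]big_mkcond; congr (_%:R);
     apply: eq_bigr => v _; case: (v \in A).
have {leA Phi0} : Phi [ffun v => (v \in A)%:R] < 1 by exact: le_lt_trans Phi0.
rewrite /Phi sumE; under eq_bigr do rewrite prodE.
have S0 : 0 <= \sum_(i : I) 2 ^+ t * 2^-1 ^+ #|[set P in F i | P \subset A]| :> R.
  by apply: sumr_ge0 => i _; rewrite mulr_ge0 ?exprn_ge0 ?invr_ge0.
have A0 : 0 <= (2 * q * #|V|%:R)^-1 * #|A|%:R :> R.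
  by rewrite mulr_ge0 ?invr_ge0 ?mulr_ge0 ?(ltW q0) ?(ltW V0').
move=> lt1; exists A; split.
  have : (2 * q * #|V|%:R)^-1 * #|A|%:R <= 1 :> R by lra.
  by rewrite mulrC ler_pdivrMr ?mul1r // !mulr_gt0.
move=> i; rewrite ltnNge; apply/negP => le.
(* An index with at most [t] members inside [A] alone contributes a term of at least 1. *)
suff : (1 : R) <= \sum_(i : I) 2 ^+ t * 2^-1 ^+ #|[set P in F i | P \subset A]| by lra.
rewrite (bigD1 i) //=; apply: ler_wpDr.
  by apply: sumr_ge0 => j _; rewrite mulr_ge0 ?exprn_ge0 ?invr_ge0.
rewrite exprVn ler_pdivlMr ?exprn_gt0 // mul1r ler_eXn2l //; lra.
Qed.

End MultiAffine.

(** * Random transversal parts *)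

Section Averaging.
Variable R : realFieldType.

(** Under a transitive action a random image of [x0] is uniform on [D]. The injection [h] replaces
    translation by a group element carrying [x] to [x0], so no group structure on [S] is assumed. *)
Lemma sum_transitive (S X : finType) (act : S -> X -> X) (D : {set X})
    (g : X -> R) (x0 : X) :
  (forall s, injective (act s)) -> (forall s x, (act s x \in D) = (x \in D)) ->
  (forall x, x \in D -> exists2 h : S -> S, injective h &
     forall s, act (h s) x = act s x0) ->
  #|D|%:R * \sum_(s : S) g (act s x0) = #|S|%:R * \sum_(x in D) g x.
Proof.
move=> inj stab trans.
transitivity (\sum_(x in D) \sum_(s : S) g (act s x)).
  rewrite mulr_natl -sumr_const; apply: eq_bigr => x xD.
  have [h hinj hE] := trans x xD; rewrite [RHS](reindex_inj hinj).
  by apply: eq_bigr => s _; rewrite hE.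
rewrite exchange_big mulr_natl -sumr_const; apply: eq_bigr => s _.
rewrite [RHS](reindex_inj (inj s)); apply: eq_bigl => x; exact: esym (stab s x).
Qed.

Lemma exists_le_average (S : finType) (Phi : S -> R) (c : R) : (0 < #|S|)%N ->
  \sum_(s : S) Phi s <= #|S|%:R * c -> exists s, Phi s <= c.
Proof.
move=> S0 le; apply/existsP; apply: contraTT le => /existsPn gt.
have /card_gt0P[s0 _] := S0.
rewrite -ltNge mulr_natl -sumr_const.
apply: ltr_sum; first by apply/hasP; exists s0; rewrite ?mem_index_enum.
by move=> s _; rewrite ltNge gt.
Qed.

(** First swap [a] with [c], then swap the image of [b] with [d]; the second swap fixes [c]. *)
Lemma perm_2transitive (T : finType) (a b c d : T) : a != b -> c != d ->
  exists p : {perm T}, p a = c /\ p b = d.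
Proof.
move=> ab cd; exists (tperm a c * tperm (tperm a c b) d)%g.
rewrite !permM tpermL; split; last by rewrite tpermL.
rewrite tpermD // 1?eq_sym //.
by apply: contra_neq ab => /(congr1 (tperm a c)); rewrite tpermK tpermR.
Qed.

Section RandomInjection.
Variables (X I : finType) (a : rel X) (E : rel I) (Good : {set I}).

(** Compose a fixed injection into [Good] with a uniform permutation. By 2-transitivity every pair
    related by [a] lands on a uniform ordered pair of distinct members of [Good], so some
    permutation hits [E] at most as often as the average. *)
Lemma random_injection : (2 <= #|Good|)%N -> (#|X| <= #|Good|)%N -> irreflexive a ->
  exists f : X -> I, [/\ injective f, forall x, f x \in Good &
    (#|[set e : X * X | a e.1 e.2 && E (f e.1) (f e.2)]| * (#|Good| * #|Good|.-1) <=
     #|[set e : X * X | a e.1 e.2]| *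
     #|[set e : I * I | [&& e.1 \in Good, e.2 \in Good, e.1 != e.2 & E e.1 e.2]]|)%N].
Proof.
move=> g2 leX irr; set g := #|Good| in g2 leX *.
pose v (i : 'I_g) : I := enum_val i.
have vinj : injective v by exact: enum_val_inj.
pose f0 (x : X) : 'I_g := widen_ord leX (enum_rank x).
have f0inj : injective f0.
  by move=> x y /(congr1 val) /= /ord_inj /enum_rank_inj.
pose act (p : 'S_g) (e : 'I_g * 'I_g) := (p e.1, p e.2).
pose D := [set e : 'I_g * 'I_g | e.1 != e.2].
pose G (e : 'I_g * 'I_g) : R := (E (v e.1) (v e.2))%:R.
have cD : #|D| = (g * g.-1)%N.
  rewrite -sum1dep_card -(pair_big_dep xpredT (fun x y : 'I_g => x != y) (fun _ _ => 1%N)) /=.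
  rewrite (eq_bigr (fun=> g.-1)) => [|i _]; first by rewrite sum_nat_const card_ord.
  by rewrite sum1dep_card; have := cardC1 i; rewrite card_ord => <-; apply: eq_card => j;
     rewrite !inE eq_sym.
have avg e0 : e0 \in D ->
    #|D|%:R * \sum_(p : 'S_g) G (act p e0) = #|{: 'S_g}|%:R * \sum_(e in D) G e.
  rewrite inE => e0D; apply: sum_transitive.
  - by move=> p [x y] [x' y'] [/perm_inj-> /perm_inj->].
  - by move=> p e; rewrite !inE /= (inj_eq perm_inj).
  - move=> e; rewrite inE => eD; have [q [q1 q2]] := perm_2transitive eD e0D.
    exists (fun p => q * p)%g; first exact: mulgI.
    by move=> p; rewrite /act !permM q1 q2.
pose Phi (p : 'S_g) : R := \sum_(e : X * X | a e.1 e.2) G (act p (f0 e.1, f0 e.2)).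
have D0 : 0 < #|D|%:R :> R by rewrite cD ltr0n muln_gt0; lia.
have [||p leP] := @exists_le_average _ Phi
    (#|[set e : X * X | a e.1 e.2]|%:R * ((\sum_(e in D) G e) / #|D|%:R)).
- by apply/card_gt0P; exists 1%g.
- rewrite /Phi exchange_big /= mulrCA mulr_natl -sumr_const.
  rewrite [leRHS](eq_bigl (fun e : X * X => a e.1 e.2)) => [|e]; last by rewrite inE.
  apply: ler_sum => e ae; rewrite mulrA ler_pdivlMr // mulrC avg // inE /=.
  apply: contraTneq ae => /f0inj ->; rewrite irr //.
exists (fun x => v (p (f0 x))); split.
- by move=> x y /vinj /perm_inj /f0inj.
- by move=> x; apply: enum_valP.
- rewrite -(ler_nat R) !natrM -natrM -cD.
  have -> : #|[set e : X * X | a e.1 e.2 && E (v (p (f0 e.1))) (v (p (f0 e.2)))]|%:R = Phi p.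
    rewrite -sum1dep_card natr_sum big_mkcondr /=; apply: eq_bigr => e _.
    by rewrite /G /=; case: (E _ _).
  have -> : #|[set e : I * I | [&& e.1 \in Good, e.2 \in Good, e.1 != e.2 & E e.1 e.2]]|%:R
      = \sum_(e in D) G e.
    rewrite (eq_bigl (fun e : 'I_g * 'I_g => e.1 != e.2)) => [|e]; last by rewrite inE.
    rewrite /G -natr_sum; congr (_%:R).
    rewrite -big_mkcondr sum1dep_card /=.
    have wI : injective (fun e : 'I_g * 'I_g => (v e.1, v e.2)).
      by move=> [x y] [x' y'] [/vinj-> /vinj->].
    rewrite -(card_imset _ wI); apply: eq_card => -[x y]; rewrite !inE /=.
    apply/idP/imsetP => [/and4P[xG yG xy Exy]|[[x' y'] /=]].
      exists (enum_rank_in xG x, enum_rank_in xG y); last by rewrite /v /= !enum_rankK_in.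
      rewrite inE /= /v !enum_rankK_in // Exy andbT.
      by apply: contra_neq xy => /(congr1 v); rewrite /v !enum_rankK_in.
    rewrite inE /= => /andP[xy Exy] [-> ->]; rewrite Exy andbT.
    by rewrite (inj_eq vinj) xy /v !enum_valP.
  by rewrite -ler_pdivlMr // -mulrA.
Qed.

End RandomInjection.
End Averaging.

Section Transversals.
Variables (R : realFieldType) (l m : nat).
Hypotheses (l0 : (0 < l)%N) (m2 : (2 <= m)%N).
Variable e : rel ('I_l * 'I_m).
Variable mu : 'I_l -> R.
Hypothesis mu0 : forall j, 0 < mu j.
Hypothesis nonadj_le : forall j y,
  #|[set p | ~~ e p (j, y)]|%:R <= (l * m)%:R * mu j.

(** The pair [(j, y)] is the [y]-th vertex of block [j], so a transversal is a choice of one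
    position in each block. *)
Notation T := {ffun 'I_l -> 'I_m}.

Definition no_edge (a b : T) := [forall i, forall j, ~~ e (i, a i) (j, b j)].

Definition missed (a : T) (j : 'I_l) : {set 'I_m} :=
  [set y | [forall i, ~~ e (i, a i) (j, y)]].

Let mR0 : 0 < m%:R :> R. Proof. by rewrite ltr0n; lia. Qed.
Let lR0 : 0 < l%:R :> R. Proof. by rewrite ltr0n. Qed.

Lemma prodb (I : finType) (b : pred I) :
  \prod_i (b i)%:R = [forall i, b i]%:R :> R.
Proof.
have [/forallP ball|/forallPn[i nb]] := boolP [forall i, b i].
  by rewrite big1 // => i _; rewrite ball.
by rewrite (bigD1 i) //= (negPf nb) mul0r.
Qed.

Lemma AGM_le (E : 'I_l -> R) (c : R) : (forall i, 0 <= E i) ->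
  \sum_i E i <= l%:R * c -> \prod_i E i <= c ^+ l.
Proof.
move=> E0 le.
have [] := leif_AGM (A := predT) (E := E) (fun i _ => E0 i).
rewrite card_ord => /le_trans + _; apply.
apply: lerXn2r; rewrite ?nnegrE.
- by rewrite divr_ge0 ?sumr_ge0 // ltW.
- rewrite -(pmulr_rge0 _ lR0); apply: le_trans le; exact: sumr_ge0.
- by rewrite ler_pdivrMr // mulrC.
Qed.

(** A random transversal misses a given vertex of block [j] with probability the product over the
    blocks of its proportions of non-neighbours. By AM-GM this is at most the [l]-th power of their
    mean, hence at most [mu j ^+ l]. *)
Lemma sum_missed j : \sum_(a : T) #|missed a j|%:R <= m%:R * (m%:R * mu j) ^+ l :> R.
Proof.
have -> : \sum_(a : T) #|missed a j|%:R =
    \sum_(y : 'I_m) \prod_i \sum_(x : 'I_m) (~~ e (i, x) (j, y))%:R :> R.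
  under [RHS]eq_bigr do rewrite bigA_distr_bigA.
  rewrite exchange_big; apply: eq_bigr => a _; under eq_bigr do rewrite prodb.
  by rewrite -natr_sum -big_mkcond sum1dep_card.
rewrite -[X in X%:R * _](card_ord m) mulr_natl -sumr_const.
apply: ler_sum => y _; apply: AGM_le => [i|]; first exact: sumr_ge0.
rewrite pair_bigA /=; apply: le_trans (_ : (l * m)%:R * mu j <= _); last first.
  by rewrite natrM mulrA.
apply: le_trans (nonadj_le j y).
rewrite -natr_sum -big_mkcond sum1dep_card ler_nat.
by apply/subset_leq_card/subsetP => -[i x]; rewrite !inE.
Qed.

Variable K : R.
Hypothesis K0 : 0 < K.

Definition balanced (a : T) :=
  [forall j, #|missed a j|%:R <= K * l%:R * m%:R * mu j ^+ l].

(** The threshold in [balanced] is [K * l] times the bound on the mean from [sum_missed], so by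
    Markov each block fails with probability at most [1 / (K * l)]; a union bound over the [l]
    blocks leaves [1 / K]. *)
Lemma unbalanced_le : #|[set a | ~~ balanced a]|%:R * K <= m%:R ^+ l.
Proof.
pose B j := [set a : T | K * l%:R * m%:R * mu j ^+ l < #|missed a j|%:R].
have cB j : #|B j|%:R * (K * l%:R) <= m%:R ^+ l.
  have muj : 0 < m%:R * mu j ^+ l by rewrite mulr_gt0 ?exprn_gt0.
  rewrite -(ler_pM2r muj); apply: le_trans (_ : m%:R * (m%:R * mu j) ^+ l <= _).
    apply: le_trans (sum_missed j).
    rewrite [leRHS](bigID (mem (B j))) /=.
    apply: ler_wpDr; first exact: sumr_ge0.
    have -> : #|B j|%:R * (K * l%:R) * (m%:R * mu j ^+ l) =
        \sum_(a in B j) K * l%:R * m%:R * mu j ^+ l.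
      by rewrite sumr_const -[RHS]mulr_natl !mulrA.
    by apply: ler_sum => a; rewrite inE => /ltW.
  by rewrite exprMn le_eqVlt; apply/orP; left; apply/eqP; ring.
have : #|[set a | ~~ balanced a]|%:R <= \sum_j #|B j|%:R :> R.
  rewrite -natr_sum ler_nat; apply: leq_trans (_ : #|\bigcup_j B j| <= _)%N.
    apply/subset_leq_card/subsetP => a; rewrite inE negb_forall => /existsP[j].
    by rewrite -ltNge => lt; apply/bigcupP; exists j => //; rewrite inE.
  elim/big_rec2: _ => [|j n A _ le]; first by rewrite cards0.
  exact: leq_trans (leq_card_setU _ _).1 (leq_add _ _).
move=> le; rewrite -(ler_pM2r lR0) -mulrA.
apply: le_trans (_ : \sum_j #|B j|%:R * (K * l%:R) <= _).
  by rewrite -mulr_suml; apply: ler_wpM2r le; rewrite mulr_ge0 ?ltW.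
have -> : m%:R ^+ l * l%:R = \sum_(j < l) m%:R ^+ l :> R.
  by rewrite sumr_const card_ord mulr_natr.
exact: ler_sum.
Qed.

Variable kap : R.
Hypothesis mu_le : \sum_j mu j <= l%:R * kap.

Let kap0 : 0 < kap.
Proof.
rewrite -(pmulr_rgt0 _ lR0); apply: lt_le_trans mu_le.
rewrite (bigD1 (Ordinal l0)) //=; apply: ltr_wpDr => //.
by apply: sumr_ge0 => j _; apply: ltW.
Qed.

(** A transversal [b] sends no edge to [a] exactly when it picks a missed vertex in every block, so
    such [b] are counted by a product. Balancedness bounds each factor, and AM-GM turns the product
    of the [mu j] into a power of [kap]. *)
Lemma balanced_no_edge a : balanced a ->
  #|[set b | no_edge a b]|%:R <= m%:R ^+ l * ((K * l%:R) ^+ l * kap ^+ (l * l)).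
Proof.
move=> /forallP bal.
have -> : #|[set b | no_edge a b]|%:R = \prod_j #|missed a j|%:R :> R.
  have cF : #|family (fun j => mem (missed a j))| = (\prod_j #|missed a j|)%N.
    by rewrite card_family foldrE big_map big_enum.
  rewrite -natr_prod -cF; congr (_%:R); apply: eq_card => b.
  rewrite inE; apply/forallP/familyP => [ne j|ne i].
    by rewrite inE; apply/forallP => i; have /forallP := ne i; apply.
  by apply/forallP => j; have := ne j; rewrite inE => /forallP.
apply: le_trans (_ : \prod_j (K * l%:R * m%:R * mu j ^+ l) <= _).
  by apply: ler_prod => j _; rewrite ler0n bal.
rewrite big_split /= prodr_const card_ord prodrXl.
have le : (\prod_j mu j) ^+ l <= kap ^+ (l * l).
  rewrite exprM; apply: lerXn2r; rewrite ?nnegrE ?exprn_ge0 ?(ltW kap0) //.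
    by apply: prodr_ge0 => j _; apply: ltW.
  by apply: AGM_le => // j; apply: ltW.
rewrite [K * l%:R * m%:R]mulrC [in leLHS]exprMn -mulrA.
apply: ler_wpM2l; first by rewrite exprn_ge0 ?ler0n.
by apply: ler_wpM2l le; rewrite exprn_ge0 ?mulr_ge0 ?ltW.
Qed.

(** A random partition into transversals: every block is permuted independently, and part [i] takes
    the image of [i] in each block. *)
Notation shuffle := {ffun 'I_l -> 'S_m}.

Let apply_shuffle (s : shuffle) (a : T) : T := [ffun j => s j (a j)].

Let apply_shuffle_inj s : injective (apply_shuffle s).
Proof.
move=> a b /ffunP eqab; apply/ffunP => j.
by have := eqab j; rewrite !ffunE => /perm_inj.
Qed.

Let shuffle_pair (s : shuffle) (ab : T * T) :=
  (apply_shuffle s ab.1, apply_shuffle s ab.2).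

Let apart := [set ab : T * T | [forall j, (ab.1 : T) j != (ab.2 : T) j]].

Let card_apart : #|apart| = (m ^ l * m.-1 ^ l)%N.
Proof.
rewrite -sum1dep_card -(pair_big_dep xpredT
  (fun a b : T => [forall j, a j != b j]) (fun _ _ => 1%N)) /=.
rewrite (eq_bigr (fun=> m.-1 ^ l)%N) => [|a _].
  by rewrite sum_nat_const card_ffun !card_ord.
rewrite sum1dep_card.
have cF : #|family (fun j => mem (predC1 (a j)))| = (m.-1 ^ l)%N.
  rewrite card_family foldrE big_map big_enum /=.
  rewrite (eq_bigr (fun=> m.-1)) => [|j _]; last by rewrite cardC1 card_ord.
  by rewrite prod_nat_const card_ord.
rewrite -cF; apply: eq_card => b; rewrite inE.
apply/forallP/familyP => [ne j|ne j].
  by rewrite inE /= eq_sym ne.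
by have := ne j; rewrite inE /= eq_sym.
Qed.

(** A shuffled pair of disjoint transversals is uniform among all such pairs: apply 2-transitivity
    in each block separately. *)
Let shuffle_pair_average (g : T * T -> R) (ab : T * T) : ab \in apart ->
  #|apart|%:R * \sum_s g (shuffle_pair s ab) =
  #|{: shuffle}|%:R * \sum_(cd in apart) g cd.
Proof.
move=> abD; apply: sum_transitive => //.
- by move=> s [a b] [a' b'] [/apply_shuffle_inj-> /apply_shuffle_inj->].
- move=> s [a b]; rewrite !inE; apply: eq_forallb => j.
  by rewrite !ffunE (inj_eq perm_inj).
move=> [c d]; rewrite inE /= => /forallP cdD.
move: abD; rewrite inE => /forallP abD.
have ex j : exists p : 'S_m, (p (c j) == ab.1 j) && (p (d j) == ab.2 j).
  by have [p [p1 p2]] := perm_2transitive (cdD j) (abD j); exists p; rewrite p1 p2 !eqxx.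
pose tau j := xchoose (ex j).
have tauE j : tau j (c j) = ab.1 j /\ tau j (d j) = ab.2 j.
  by have /andP[/eqP p1 /eqP p2] := xchooseP (ex j).
exists (fun s : shuffle => [ffun j => (tau j * s j)%g]).
  move=> s s' /ffunP eqs; apply/ffunP => j.
  by have := eqs j; rewrite !ffunE => /mulgI.
move=> s; congr pair; apply/ffunP => j; rewrite !ffunE permM.
- by rewrite (tauE j).1.
- by rewrite (tauE j).2.
Qed.

Let shuffle_average (g : T -> R) (a : T) :
  #|{: T}|%:R * \sum_s g (apply_shuffle s a) = #|{: shuffle}|%:R * \sum_c g c.
Proof.
have -> : \sum_c g c = \sum_(c in [set: T]) g c by apply: eq_bigl => c; rewrite inE.
rewrite -[in LHS](cardsT T).
apply: sum_transitive => [s|s x|c _].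
- exact: apply_shuffle_inj.
- by rewrite !inE.
exists (fun s : shuffle => [ffun j => (tperm (c j) (a j) * s j)%g]).
  move=> s s' /ffunP eqs; apply/ffunP => j.
  by have := eqs j; rewrite !ffunE => /mulgI.
by move=> s; apply/ffunP => j; rewrite !ffunE permM tpermL.
Qed.

(** First moment over shuffles. A single part is a uniform transversal, which controls the
    unbalanced ones; a pair of parts is a uniform disjoint pair, which controls the pairs without an
    edge. *)
Lemma random_parts : exists A : 'I_m -> T,
  [/\ forall i i', i != i' -> forall j, A i j != A i' j,
      #|[set i | ~~ balanced (A i)]|%:R * K <= 2 * m%:R &
      #|[set ii : 'I_m * 'I_m | [&& ii.1 != ii.2, balanced (A ii.1) &
           no_edge (A ii.1) (A ii.2)]]|%:R
        <= 2 * 2 ^+ l * (K * l%:R) ^+ l * kap ^+ (l * l) * m%:R ^+ 2].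
Proof.
pose cst (i : 'I_m) : T := [ffun=> i].
pose A (s : shuffle) i := apply_shuffle s (cst i).
pose nbad s : R := \sum_i (~~ balanced (A s i))%:R.
pose G (ab : T * T) : R := (balanced ab.1 && no_edge ab.1 ab.2)%:R.
pose nfail s : R := \sum_(ii : 'I_m * 'I_m | ii.1 != ii.2) G (A s ii.1, A s ii.2).
set psi := (K * l%:R) ^+ l * kap ^+ (l * l).
have psi0 : 0 < psi by rewrite mulr_gt0 ?exprn_gt0 ?mulr_gt0.
have S0 : 0 < #|{: shuffle}|%:R :> R.
  by rewrite ltr0n; apply/card_gt0P; exists [ffun=> 1%g].
have mX0 : 0 < m%:R ^+ l :> R by rewrite exprn_gt0.
have sum_bad : \sum_s nbad s * K <= #|{: shuffle}|%:R * m%:R.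
  rewrite -mulr_suml /nbad exchange_big /= mulr_suml.
  rewrite -[X in _ * X%:R](card_ord m) mulr_natr -sumr_const; apply: ler_sum => i _.
  have := shuffle_average (fun a => (~~ balanced a)%:R) (cst i).
  rewrite card_ffun !card_ord natrX => avg.
  rewrite -(ler_pM2l mX0) mulrA avg -mulrA [leRHS]mulrC ler_pM2l //.
  apply: le_trans unbalanced_le; apply: (ler_wpM2r (ltW K0)).
  by rewrite -natr_sum -big_mkcond sum1dep_card.
have sumG : \sum_(cd in apart) G cd <= m%:R ^+ l * (m%:R ^+ l * psi).
  apply: le_trans (_ : \sum_(cd : T * T) G cd <= _).
    rewrite [leRHS](bigID (mem apart)) /=.
    by apply: ler_wpDr => //; apply: sumr_ge0 => cd _; rewrite /G.
  rewrite -(pair_bigA _ (fun a b => G (a, b))) /=.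
  apply: le_trans (_ : \sum_(a : T) m%:R ^+ l * psi <= _); last first.
    by rewrite sumr_const card_ffun !card_ord -[leLHS]mulr_natl natrX.
  apply: ler_sum => a _; rewrite /G /=.
  have [bal|nbal] := boolP (balanced a); last first.
    by rewrite big1 // mulr_ge0 // ltW.
  apply: le_trans (balanced_no_edge bal).
  by rewrite -natr_sum -big_mkcond sum1dep_card.
(* Disjoint pairs form at least a [2 ^ (- l)] fraction of all pairs, since [m <= 2 * (m - 1)]; this
   is the source of the factor [2 ^+ l]. *)
have apart_ge : m%:R ^+ l * m%:R ^+ l <= 2 ^+ l * #|apart|%:R :> R.
  rewrite card_apart natrM mulrCA !natrX; apply: (ler_wpM2l (ltW mX0)).
  rewrite -exprMn; apply: lerXn2r; rewrite ?nnegrE ?mulr_ge0 //.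
  by rewrite -natrM ler_nat; move: m2; clear; lia.
have sum_fail : \sum_s nfail s <= #|{: shuffle}|%:R * (2 ^+ l * psi * m%:R ^+ 2).
  rewrite /nfail exchange_big /=.
  apply: le_trans (_ : \sum_(ii : 'I_m * 'I_m) #|{: shuffle}|%:R * (2 ^+ l * psi) <= _).
    rewrite [leRHS](bigID (fun ii : 'I_m * 'I_m => ii.1 != ii.2)) /=.
    apply: ler_wpDr.
      apply: sumr_ge0 => ii _; apply: mulr_ge0 => //.
      by apply: mulr_ge0 (ltW psi0); apply: exprn_ge0.
    apply: ler_sum => -[i i'] /= ii'.
    have capart : (cst i, cst i') \in apart.
      by rewrite inE; apply/forallP => j; rewrite !ffunE.
    have := shuffle_pair_average G capart; rewrite /shuffle_pair /= => avg.
    set X := \sum_s _ in avg *; have X0 : 0 <= X by apply: sumr_ge0 => s _; rewrite /G.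
    have mm0 : 0 < m%:R ^+ l * m%:R ^+ l :> R by rewrite mulr_gt0.
    have leX : m%:R ^+ l * m%:R ^+ l * X <= 2 ^+ l * #|apart|%:R * X.
      exact: ler_wpM2r X0 _ _ apart_ge.
    rewrite -(ler_pM2l mm0); apply: le_trans leX _.
    rewrite -mulrA avg mulrCA [leRHS]mulrCA ler_pM2l // mulrCA ler_pM2l ?exprn_gt0 //.
    by rewrite -mulrA.
  rewrite sumr_const card_prod card_ord -[leLHS]mulr_natl natrM le_eqVlt.
  by apply/orP; left; apply/eqP; ring.
have D0 : 0 < 2 * 2 ^+ l * psi * m%:R ^+ 2.
  do 2 (apply: mulr_gt0; last by [] || exact: exprn_gt0).
  by apply: mulr_gt0 => //; exact: exprn_gt0.
(* Each count is divided by twice the bound on its mean, so the average of [Phi] is at most 1 and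
   one shuffle meets both bounds, each with a loss of a factor 2. *)
pose Phi s := nbad s * K / (2 * m%:R) + nfail s / (2 * 2 ^+ l * psi * m%:R ^+ 2).
have [||s le1] := @exists_le_average _ _ Phi 1.
- by rewrite -(ltr0n R).
- rewrite /Phi big_split /= -!mulr_suml mulr1.
  have : (\sum_s nbad s * K) / (2 * m%:R) <= #|{: shuffle}|%:R / 2.
    rewrite ler_pdivrMr ?mulr_gt0 //; apply: le_trans sum_bad _.
    by rewrite le_eqVlt; apply/orP; left; apply/eqP; field.
  have : (\sum_s nfail s) / (2 * 2 ^+ l * psi * m%:R ^+ 2) <= #|{: shuffle}|%:R / 2.
    rewrite ler_pdivrMr //; apply: le_trans sum_fail _.
    by rewrite le_eqVlt; apply/orP; left; apply/eqP; field.
  by rewrite -mulr_suml; lra.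
have bad0 : 0 <= nbad s * K / (2 * m%:R).
  by rewrite divr_ge0 ?mulr_ge0 ?(ltW K0) ?sumr_ge0.
have fail0 : 0 <= nfail s / (2 * 2 ^+ l * psi * m%:R ^+ 2).
  by apply: divr_ge0 (ltW D0); apply: sumr_ge0 => ii _; rewrite /G.
exists (A s); split.
- by move=> i i' ii' j; rewrite !ffunE (inj_eq perm_inj).
- have : nbad s * K / (2 * m%:R) <= 1 by move: le1 fail0; rewrite /Phi; lra.
  rewrite ler_pdivrMr ?mulr_gt0 // mul1r; apply: le_trans.
  by rewrite /nbad -natr_sum -big_mkcond sum1dep_card.
- have : nfail s / (2 * 2 ^+ l * psi * m%:R ^+ 2) <= 1 by move: le1 bad0; rewrite /Phi; lra.
  rewrite ler_pdivrMr // mul1r /psi !mulrA; apply: le_trans.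
  rewrite /nfail /G /= -natr_sum -big_mkcondr sum1dep_card ler_nat.
  by apply/subset_leq_card/subsetP => ii; rewrite !inE.
Qed.

End Transversals.

(* Cut [W], sorted by [f], into consecutive blocks: the maximum of [f] over one
   block is at most its mean over the next block. *)
Lemma sorted_blocks (R : realFieldType) (V : finType) (f : V -> R) (W : {set V})
    (l m : nat) :
  (0 < l)%N -> (0 < m)%N -> #|W| = (l * m)%N -> (forall v, 0 <= f v <= 1) ->
  exists b : 'I_l * 'I_m -> V, exists mu : 'I_l -> R,
    [/\ injective b, forall p, b p \in W, forall j y, f (b (j, y)) <= mu j,
        forall j, exists2 w, w \in W & mu j = f w
      & m%:R * \sum_j mu j <= m%:R + \sum_(w in W) f w].
Proof.
move=> l0 m0 cW f01.
have [v0 _] : exists v, v \in W by apply/card_gt0P; rewrite cW muln_gt0 l0.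
pose le_f := [rel u v | f u <= f v].
pose s := sort le_f (enum W).
have le_f_trans : transitive le_f by move=> u v w /=; apply: le_trans.
have srt : sorted le_f s by apply: sort_sorted => u v; apply: le_total.
have sz : size s = (l * m)%N by rewrite size_sort -cardE.
have us : uniq s by rewrite sort_uniq enum_uniq.
pose x k := nth v0 s k.
have lt_idx (j : 'I_l) (y : 'I_m) : (j * m + y < l * m)%N.
  by have := ltn_ord j; have := ltn_ord y; nia.
have mono i k : (i <= k)%N -> (k < l * m)%N -> f (x i) <= f (x k).
  move=> ik kl; apply: (sorted_leq_nth le_f_trans _ v0 srt) => //.
  - by move=> u /=.
  - by rewrite inE sz; lia.
  - by rewrite inE sz.
pose b (p : 'I_l * 'I_m) := x (p.1 * m + p.2)%N.
have b_inj : injective b.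
  move=> [j y] [j' y'] /eqP; rewrite nth_uniq ?sz ?lt_idx //= => /eqP e.
  have ej : val j = val j'.
    have /= := congr1 (divn^~ m) e.
    by rewrite !divnMDl // !divn_small // !addn0.
  have ey : val y = val y' by move: e; rewrite ej => /addnI.
  by congr pair; apply: val_inj.
have bW p : b p \in W.
  by rewrite -mem_enum -(mem_sort le_f) mem_nth // -/s sz; apply: lt_idx.
have sumW : \sum_(w in W) f w = \sum_j \sum_y f (b (j, y)).
  have -> : W = b @: setT.
    apply/esym/eqP; rewrite eqEcard; apply/andP; split.
      by apply/subsetP => w /imsetP[p _ ->].
    by rewrite card_imset // cardsT card_prod !card_ord cW.
  rewrite big_imset /=; last by move=> p q _ _; apply: b_inj.
  by rewrite pair_bigA; apply: eq_big => [p|[j y] _] //; rewrite inE.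
pose mu (j : 'I_l) := f (x (j * m + m.-1)%N).
have lt_last (j : 'I_l) : (j * m + m.-1 < l * m)%N by have := ltn_ord j; nia.
exists b, mu; split=> //.
- move=> j y; apply: mono (lt_last j); rewrite leq_add2l /= -ltnS prednK // ltn_ord.
- move=> j; exists (x (j * m + m.-1)%N) => //.
  by rewrite -mem_enum -(mem_sort le_f) mem_nth // -/s sz.
rewrite sumW mulr_sumr.
case: l l0 {cW} sz lt_idx mono @b b_inj bW sumW @mu lt_last => // l _ sz lt_idx mono
  b b_inj bW _ mu lt_last.
(* The last block has no successor: its maximum is bounded by 1, which costs the extra [m%:R]. The
   first block's sum on the right is simply discarded. *)
rewrite big_ord_recr [leLHS]addrC [in leRHS]big_ord_recl /=; apply: lerD.
  rewrite -[leRHS]mulr1; apply: ler_wpM2l => //.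
  by have /andP[_ le1] := f01 (x (l * m + m.-1)%N); apply: le1.
apply: ler_wpDl.
  by apply: sumr_ge0 => y _; case/andP: (f01 (b (ord0, y))).
apply: ler_sum => j _; rewrite -[X in X%:R * _](card_ord m) mulr_natl -sumr_const.
apply: ler_sum => y _; apply: mono; last by have := lt_idx (lift ord0 j) y.
by rewrite /= /bump /=; nia.
Qed.

Lemma card_adj (G : sgraph) :
  #|[set e : G * G | adj e.1 e.2]| = (2 * #|edges G|)%N.
Proof.
pose pr (e : G * G) := [set e.1; e.2].
rewrite -sum1_card (partition_big pr (mem (edges G))) /=; last first.
  move=> [x y]; rewrite !inE /= => xy; apply/existsP; exists x.
  by apply/existsP; exists y; rewrite xy /pr /=.
rewrite mulnC -sum_nat_const; apply: eq_bigr => e.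
rewrite inE => /existsP[x /existsP[y /andP[xy /eqP->]]].
have nxy : x != y by apply: contraTneq xy => ->; rewrite adj_irr.
rewrite sum1dep_card (_ : [set _ | _] = [set (x, y); (y, x)]).
  by rewrite cards2 xpair_eqE negb_and nxy.
apply/setP => -[u v]; rewrite !inE /= !xpair_eqE /pr /=.
apply/andP/orP => [[uv /eqP/setP e2]|[]/andP[/eqP-> /eqP->]]; last 2 first.
- by rewrite xy eqxx.
- by rewrite adj_sym xy setUC eqxx.
have := e2 u; have := e2 v; rewrite !inE !eqxx /= orbT => /esym + /esym.
have nuv : u != v by apply: contraTneq uv => ->; rewrite adj_irr.
move=> /orP[]/eqP ev /orP[]/eqP eu; subst u v; rewrite ?eqxx //;
  by [left|right|rewrite eqxx in nuv].
Qed.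

Lemma square_le_falling (m g : nat) :
  (2 <= g)%N -> (m <= 2 * g)%N -> (m * m <= 8 * (g * g.-1))%N.
Proof.
case: g => // g; rewrite ltnS /= => g1 mg.
by apply: leq_trans (leq_mul mg mg) _; nia.
Qed.

(** * Assigning the vertices of [H] to balanced parts *)

Section GoodParts.
Variables (R : realFieldType) (G H : sgraph).

(** Sort [W] by proportion of non-neighbours and split it by [random_parts]. At least a fraction
    [1 - 2 / K] of the parts is balanced, enough for [H], and a random injection of [H] into these
    spreads the failing pairs evenly. *)
Lemma good_parts (W : {set G}) (l m : nat) (k0 K : R) :
  (0 < l)%N -> (4 <= m)%N -> #|W| = (l * m)%N ->
  \sum_(w in W) #|[set u in W | ~~ adj u w]|%:R <= (l * m)%:R ^+ 2 * k0 ->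
  4 <= K -> #|H|%:R <= m%:R * (1 - 2 / K) ->
  exists U : H -> {set G},
    [/\ forall h, U h != set0, forall h, (#|U h| <= l)%N, forall h, U h \subset W,
        forall h k, h != k -> [disjoint U h & U k] &
        #|[set e : H * H | adj e.1 e.2 &&
             ~~ [exists x in U e.1, exists y in U e.2, adj x y]]|%:R <=
        16 * 2 ^+ l * (K * l%:R) ^+ l * (k0 + l%:R^-1) ^+ (l * l) * (2 * #|edges H|)%:R].
Proof.
move=> l0 m4 cW nonadj K4 leH.
have m0 : (0 < m)%N by lia.
have lR0 : 0 < l%:R :> R by rewrite ltr0n.
have mR0 : 0 < m%:R :> R by rewrite ltr0n.
have lm0 : 0 < (l * m)%:R :> R by rewrite natrM mulr_gt0.
pose f (w : G) : R := #|[set u in W | ~~ adj u w]|%:R / (l * m)%:R.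
have f01 w : 0 <= f w <= 1.
  rewrite divr_ge0 //= ler_pdivrMr // mul1r ler_nat -cW.
  by apply/subset_leq_card/subsetP => u; rewrite inE => /andP[].
have [b [mu [binj bW fmu mufw summu]]] := sorted_blocks l0 m0 cW f01.
(* Every vertex is its own non-neighbour, so the proportions never vanish. *)
have mu0 j : 0 < mu j.
  have [w wW ->] := mufw j; rewrite divr_gt0 // ltr0n.
  by apply/card_gt0P; exists w; rewrite !inE wW adj_irr.
pose e : rel ('I_l * 'I_m) := [rel p q | adj (b p) (b q)].
have eP j y : #|[set p | ~~ e p (j, y)]|%:R <= (l * m)%:R * mu j.
  rewrite mulrC -ler_pdivrMr //; apply: le_trans (fmu j y).
  rewrite ler_pdivrMr // divfK ?gt_eqF // ler_nat -(card_imset _ binj).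
  apply/subset_leq_card/subsetP => w /imsetP[p]; rewrite inE => pe ->.
  by rewrite inE bW.
have mule : \sum_j mu j <= l%:R * (k0 + l%:R^-1).
  rewrite -(ler_pM2l mR0); apply: le_trans summu _.
  have : \sum_(w in W) f w <= (l * m)%:R * k0.
    rewrite -mulr_suml ler_pdivrMr //; apply: le_trans nonadj _.
    by rewrite le_eqVlt; apply/orP; left; apply/eqP; ring.
  move=> le; apply: le_trans (lerD (lexx _) le) _.
  by rewrite le_eqVlt; apply/orP; left; apply/eqP; rewrite natrM; field; rewrite gt_eqF.
have K0 : 0 < K by lra.
have m2 : (2 <= m)%N by apply: leq_trans m4.
have [A [Aapart Abad Afail]] := random_parts l0 m2 mu0 eP K0 mule.
pose Good := [set i | balanced e mu K (A i)].
have cG : #|Good|%:R >= m%:R * (1 - 2 / K).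
  have := cardsC Good; rewrite card_ord => /(congr1 (fun n => n%:R : R)).
  rewrite natrD (_ : ~: Good = [set i | ~~ balanced e mu K (A i)]); last first.
    by apply/setP => i; rewrite !inE.
  move=> eG; suff : #|[set i | ~~ balanced e mu K (A i)]|%:R <= m%:R * (2 / K) by lra.
  by rewrite mulrA ler_pdivlMr // [leRHS]mulrC.
have K2 : 2 / K <= 2^-1 by rewrite ler_pdivrMr //; lra.
have gm : m%:R <= 2 * #|Good|%:R :> R.
  have : m%:R * (2 / K) <= m%:R * 2^-1 by exact: ler_wpM2l (ltW mR0) _ _ K2.
  by move: cG; lra.
have gm' : (m <= 2 * #|Good|)%N by rewrite -(ler_nat R) natrM.
have g2 : (2 <= #|Good|)%N by move: (leq_trans m4 gm'); rewrite (leq_pmul2l (m := 2) (n1 := 2)).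
have HG : (#|H| <= #|Good|)%N by rewrite -(ler_nat R); apply: le_trans cG.
have [F [Finj FG Ffail]] := random_injection R (fun i i' => no_edge e (A i) (A i')) g2 HG
   (@adj_irr H).
pose U h := [set b (j, A (F h) j) | j : 'I_l].
exists U; split.
- by move=> h; apply/set0Pn; exists (b (Ordinal l0, A (F h) (Ordinal l0))); apply: imset_f.
- by move=> h; rewrite -[X in (_ <= X)%N](card_ord l); apply: leq_imset_card.
- by move=> h; apply/subsetP => w /imsetP[j _ ->].
- move=> h k hk; rewrite -setI_eq0; apply/eqP/setP => w; rewrite in_set0.
  apply/negP => /setIP[/imsetP[j _ ->] /imsetP[j' _ /binj[<-]]] /eqP.
  by apply/negP/Aapart; rewrite (inj_eq Finj).
set fails := [set _ | _].
have failsP : (#|fails| * (#|Good| * #|Good|.-1) <= (2 * #|edges H|) *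
   #|[set ii : 'I_m * 'I_m | [&& ii.1 != ii.2, balanced e mu K (A ii.1) &
           no_edge e (A ii.1) (A ii.2)]]|)%N.
  rewrite -card_adj; apply: leq_trans (leq_trans Ffail _).
    rewrite leq_mul2r; apply/orP; right; apply/subset_leq_card/subsetP => -[h k].
    rewrite !inE /= => /andP[-> /= ne]; apply/forallP => i; apply/forallP => j.
    apply: contra ne => ij; apply/exists_inP; exists (b (i, A (F h) i)).
      exact: imset_f.
    by apply/exists_inP; exists (b (j, A (F k) j)); rewrite ?imset_f.
  rewrite leq_mul2l; apply/orP; right; apply/subset_leq_card/subsetP => -[i i'].
  by rewrite !inE /= => /and4P[-> _ -> ->].
(* The constant 16 is the 2 of [random_parts] times the 8 lost in comparing [m ^ 2] with the number
   of ordered pairs of balanced parts. *)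
set psi := 2 * 2 ^+ l * (K * l%:R) ^+ l * (k0 + l%:R^-1) ^+ (l * l) in Afail.
rewrite (_ : 16 * _ * _ * _ = 8 * psi); last by rewrite /psi; ring.
move: failsP; rewrite -(ler_nat R) !natrM => failsP.
have gg : m%:R ^+ 2 <= 8 * (#|Good|%:R * #|Good|.-1%:R) :> R.
  by rewrite -natrX -!natrM ler_nat -mulnn; apply: square_le_falling.
have mm0 : 0 < m%:R ^+ 2 :> R by rewrite exprn_gt0.
rewrite -(ler_pM2r mm0).
apply: le_trans (ler_wpM2l (ler0n _ _) gg) _.
rewrite mulrCA; set E := 2 * _ in failsP *.
have E0 : 0 <= E by rewrite mulr_ge0.
have := le_trans failsP (ler_wpM2l E0 Afail); lra.
Qed.

End GoodParts.

(** * The theorem with explicit parameters *)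

Section ReservedMinor.
Variables (R : realFieldType) (G H : sgraph).

(** Viewing a neighbourhood as a family of singletons lets one application of [random_reserve]
    handle degrees into the reserve along with links. *)
Lemma neighbour_singletons (x : G) (A : {set G}) :
  let F := [set [set z] | z in nbh x] in
  [/\ trivIset F, #|F| = #|nbh x| & #|[set P in F | P \subset A]| = #|nbh x :&: A|].
Proof.
split.
- apply/trivIsetP => P Q /imsetP[z _ ->] /imsetP[z' _ ->] zz'.
  by rewrite disjoints1 inE; apply: contra_neq zz' => ->.
- by rewrite card_imset //; apply: set1_inj.
- rewrite -(card_imset (nbh x :&: A) set1_inj); apply: eq_card => P; rewrite inE.
  apply/andP/imsetP => [[/imsetP[z zx ->]]|[z /setIP[zx zA] ->]].
    by rewrite sub1set => zA; exists z; rewrite // inE zx.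
  by rewrite sub1set zA imset_f.
Qed.

(** Pigeonhole: a vertex of [X] lies in at most one member of a disjoint family. *)
Lemma disjoint_member (V : finType) (F : {set {set V}}) (A X : {set V}) :
  trivIset F -> (#|X| < #|[set P in F | P \subset A]|)%N ->
  exists P, [/\ P \in F, P \subset A & [disjoint P & X]].
Proof.
move=> tF lt.
have [/exists_inP[P PF /andP[PA dP]]|none] :=
  boolP [exists P in F, (P \subset A) && [disjoint P & X]]; first by exists P.
exfalso; move: lt; apply/negP; rewrite -leqNgt.
have meet P : P \in [set P in F | P \subset A] -> exists v, v \in P :&: X.
  rewrite inE => /andP[PF PA]; apply/set0Pn; rewrite setI_eq0.
  by apply: contra none => dP; apply/exists_inP; exists P; rewrite ?PA.
pose pt (P : {set V}) := [pick v in P :&: X].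
have ptP P : P \in [set P in F | P \subset A] -> exists2 v, pt P = Some v & v \in P :&: X.
  move=> /meet[v vPX]; rewrite /pt; case: pickP => [w wPX|/(_ v)]; first by exists w.
  by rewrite vPX.
rewrite -(@card_in_imset _ _ pt) => [|P Q PF QF ptPQ].
  rewrite -(card_imset X (@Some_inj _)); apply/subset_leq_card/subsetP => w.
  by case/imsetP=> P /ptP[v -> /setIP[_ vX]] ->; apply: imset_f.
have [v vP /setIP[vPP _]] := ptP P PF; have [w wQ /setIP[wQQ _]] := ptP Q QF.
move: ptPQ; rewrite vP wQ => -[vw]; subst w.
move: PF QF; rewrite !inE => /andP[PF _] /andP[QF _].
apply: contraTeq vPP => PQ; have dPQ := trivIsetP tF P Q PF QF PQ.
by rewrite (disjointFl dPQ).
Qed.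

(** [random_reserve] is applied to families indexed by ordered pairs: links for distinct nonadjacent
    pairs, singletons of neighbours otherwise. The diagonal pairs yield the degrees into [A];
    adjacent pairs need no link and only fill the index set. *)
Lemma linking_reserve (k D i M t : nat) (q : R) :
  k_connected G k -> (D <= k)%N -> (#|G| < i.+1 * D)%N ->
  (M * (3 * i + 1) <= k - D)%N -> 0 < q -> q <= 1 ->
  #|G|%:R ^+ 2 * (2 ^+ t * (1 - 2^-1 * q ^+ (3 * i + 1)) ^+ M) < 2^-1 ->
  exists A : {set G}, [/\ #|A|%:R <= 2 * q * #|G|%:R,
    forall x, (t < #|nbh x :&: A|)%N &
    forall (x y : G) (X : {set G}), (#|X| <= t)%N ->
     exists P : {set G}, [/\ P \subset A, [disjoint P & X], (#|P| <= 3 * i + 1)%N,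
        rooted x (x |: P) & x != y -> exists2 z, z \in x |: P & adj z y]].
Proof.
move=> kG Dk big Mk q0 q1 small.
have G0 : (0 < #|G|)%N by case/andP: kG => /(leq_ltn_trans (leq0n k)).
pose single x : {set {set G}} := [set [set z] | z in nbh x].
have fam (e : G * G) : exists F : {set {set G}},
    [/\ trivIset F, {in F, forall P : {set G}, (#|P| <= 3 * i + 1)%N}, (M <= #|F|)%N,
        e.1 = e.2 \/ adj e.1 e.2 -> F = single e.1
      & e.1 != e.2 -> ~~ adj e.1 e.2 -> {in F, forall P : {set G}, link e.1 e.2 P}].
  case: e => x y /=; have [xy|/norP[xy nxy]] := boolP ((x == y) || adj x y).
    exists (single x); have [tF cF _] := neighbour_singletons x set0; split=> //.
    - by move=> P /imsetP[z _ ->]; rewrite cards1 addn1.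
    - rewrite cF; apply: leq_trans (k_connected_degree x kG).
      apply: leq_trans (leq_trans Mk (leq_subr _ _)).
      by rewrite leq_pmulr // addn1.
    - by move=> nxy /negPf axy; rewrite (negPf nxy) axy in xy.
  have [F [tF cF lF MF]] := link_family
    (fun z => k_connected_degree z kG) (fun X => k_connected_connected kG)
    Dk big xy nxy.
  exists F; split=> //; last by case=> [/eqP|]; apply/contraTeq; rewrite ?xy ?nxy.
  have := leq_ltn_trans Mk MF; rewrite ltn_pmul2r ?addn1 //; exact: ltnW.
have [F FP] := fin_all_exists fam.
have [||||A [cA FA]] := @random_reserve R G (G * G)%type F (3 * i + 1) M t q q0 q1 G0.
- by move=> e; case: (FP e).
- by move=> e P; case: (FP e) => _ cF _ _ _; apply: cF.
- by move=> e; case: (FP e).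
- by rewrite card_prod natrM -expr2.
exists A; split=> // [x|x y X Xt].
- have [_ _ <-] := neighbour_singletons x A; rewrite -/(single x).
  by have := FA (x, x); have [_ _ _ -> //] := FP (x, x); left.
have [<-|xy] := eqVneq x y.
  exists set0; rewrite sub0set cards0 -setI_eq0 set0I; split=> //; exact: rooted1.
have [axy|nxy] := boolP (adj x y).
  exists set0; rewrite sub0set cards0 -setI_eq0 set0I; split=> //; first exact: rooted1.
  by exists x; rewrite // !inE eqxx.
have [tF cF _ _ lF] := FP (x, y).
have [P [PF PA PX]] := disjoint_member tF (leq_ltn_trans Xt (FA (x, y))).
have [rP ex] := lF xy nxy P PF.
by exists P; split=> //; apply: cF.
Qed.

(** Ordered adjacent pairs not inside [W] have an end outside [W], so there are at most
    [2 * #|G| * (#|G| - #|W|)] of them. *)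
Lemma nonadjacent_pairs (W : {set G}) :
  (\sum_(w in W) #|[set u in W | ~~ adj u w]| + 2 * #|edges G| <=
   #|W| * #|W| + 2 * (#|G| * (#|G| - #|W|)))%N.
Proof.
have cWC : (#|G| - #|W|)%N = #|~: W| by rewrite -(cardsC W) addKn.
have split_adj : (2 * #|edges G| <=
    \sum_(w in W) #|[set u in W | adj u w]| + 2 * (#|G| * #|~: W|))%N.
  rewrite -card_adj.
  pose A := [set e : G * G | [&& e.1 \in W, e.2 \in W & adj e.1 e.2]].
  pose B := setX (~: W) [set: G]; pose C := setX [set: G] (~: W).
  apply: leq_trans (_ : #|A :|: (B :|: C)| <= _)%N.
    apply/subset_leq_card/subsetP => -[u w]; rewrite !inE /= => ->.
    by case: (u \in W); case: (w \in W).
  apply: leq_trans (leq_card_setU _ _).1 _; apply: leq_add.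
    rewrite -sum1dep_card (eq_bigl (fun e : G * G => (e.2 \in W) && ((e.1 \in W) && adj e.1 e.2)));
      last by move=> e; rewrite andbCA.
    rewrite -(pair_big_dep xpredT
      (fun u w => (w \in W) && ((u \in W) && adj u w)) (fun _ _ => 1%N)) /=.
    rewrite (exchange_big_dep (mem W)) /=; last by move=> u w _ /andP[].
    by apply: leq_sum => w ->; rewrite sum1dep_card.
  apply: leq_trans (leq_card_setU _ _).1 _.
  by rewrite !cardsX cardsT mulnC mulSn mul1n.
rewrite cWC; apply: leq_trans (leq_add (leqnn _) split_adj) _.
rewrite addnA leq_add2r -big_split /= -sum_nat_const; apply: leq_sum => w _.
rewrite addnC -(cardsID [set u | adj u w] W); apply: eq_leq; congr (_ + _)%N.
all: by apply: eq_card => u; rewrite !inE // andbC.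
Qed.

(** The reserve tolerates the loss of [t] vertices while the construction uses only [t']; the
    remaining [t - t'] reserve neighbours of each vertex are what domination works with. The blocks
    are cut from the complement of the reserve. *)
Lemma minor_of_parameters (k D i M t t' s l m : nat) (q c k0 K : R) :
  k_connected G k -> (D <= k)%N -> (#|G| < i.+1 * D)%N ->
  (M * (3 * i + 1) <= k - D)%N -> 0 < q -> q <= 1 ->
  #|G|%:R ^+ 2 * (2 ^+ t * (1 - 2^-1 * q ^+ (3 * i + 1)) ^+ M) < 2^-1 ->
  (t' < t)%N -> 0 < c -> c <= 1 -> c * #|G|%:R <= (t - t')%:R ->
  l%:R * (1 - c) ^+ s < 1 ->
  (0 < l)%N -> (4 <= m)%N -> (l * m)%:R <= #|G|%:R - 2 * q * #|G|%:R ->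
  (l * m)%:R ^+ 2 + 2 * (#|G|%:R * (#|G|%:R - (l * m)%:R)) - 2 * #|edges G|%:R
    <= (l * m)%:R ^+ 2 * k0 ->
  4 <= K -> #|H|%:R <= m%:R * (1 - 2 / K) ->
  16 * 2 ^+ l * (K * l%:R) ^+ l * (k0 + l%:R^-1) ^+ (l * l) * (2 * #|edges H|)%:R
    <= #|H|%:R ->
  (#|H| * (s + s * (3 * i + 1) + (3 * i + 1)) <= t')%N ->
  minor G H.
Proof.
move=> kG Dk big Mk q0 q1 small tt c0 c1 cn ls l0 m4 lm_le sparse K4 HK fail_le le_t.
have [A [cA degA linkA]] := linking_reserve kG Dk big Mk q0 q1 small.
have cWle : (l * m <= #|~: A|)%N.
  have /(congr1 (fun n => n%:R : R)) := cardsC A; rewrite natrD => eA.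
  by rewrite -(ler_nat R); lra.
have [W WA cW] : exists2 W : {set G}, W \subset ~: A & #|W| = (l * m)%N.
  exists [set x in take (l * m) (enum (~: A))].
    by apply/subsetP => x; rewrite inE => /mem_take; rewrite mem_enum.
  rewrite cardsE (card_uniqP _) ?take_uniq ?enum_uniq //.
  by rewrite size_takel // -cardE.
have lmG : (l * m <= #|G|)%N by rewrite -cW; apply: max_card.
have nonadj : \sum_(w in W) #|[set u in W | ~~ adj u w]|%:R <= (l * m)%:R ^+ 2 * k0.
  apply: le_trans sparse; rewrite -natr_sum.
  have := nonadjacent_pairs W; rewrite cW -(ler_nat R) !natrD !natrM natrB //.
  by rewrite !natrM; lra.
have [U [U0 cU UW UU failU]] := good_parts l0 m4 cW nonadj K4 HK.
have {fail_le}failU := le_trans failU fail_le; rewrite ler_nat in failU.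
apply: (@minor_of_parts G H A t' (3 * i + 1) s U
   (fun h k => adj h k && ~~ [exists x in U h, exists y in U k, adj x y])) => //.
- by move=> x y X Xt; apply: linkA; apply: leq_trans Xt (ltnW tt).
- move=> h X Xt; have [|||S [SA cS dom]] :=
    @dominating_set R G (A :\: X) (U h) (t - t') s c c0 c1 cn.
  + by rewrite subn_gt0.
  + move=> u _; rewrite setIDA cardsD; apply: leq_sub (ltnW (degA u)) _.
    exact: leq_trans (subset_leq_card (subsetIr _ _)) Xt.
  + apply: le_lt_trans ls; apply: ler_wpM2r; last by rewrite ler_nat.
    by rewrite exprn_ge0; lra.
  exists S; split=> //.
  + by apply: subset_trans SA (subsetDl _ _).
  + rewrite -setI_eq0; apply/eqP/setP => w; rewrite !inE.
    by apply/negP => /andP[/(subsetP SA)]; rewrite !inE => /andP[/negP].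
- move=> h; rewrite -setI_eq0; apply/eqP/setP => w; rewrite !inE.
  by apply/negP => /andP[/(subsetP (UW h))/(subsetP WA)]; rewrite inE => /negP.
- move=> h k' hk; rewrite hk /= negbK => /exists_inP[x xU /exists_inP[y yU xy]].
  by exists x, y.
apply: leq_trans le_t; set L := (3 * i + 1)%N.
rewrite 2!(mulnDr #|H|) mulnA; apply: leq_add => //.
by rewrite leq_mul2r failU orbT.
Qed.

End ReservedMinor.

(** * Choice of the parameters *)

Section Estimates.
Variable R : realType.
Implicit Types (x c eps : R).

Lemma cube_lt_expR x : 0 <= x -> x ^+ 3 < 6 * expR x.
Proof.
move=> x0; have := expR_ge1Dxn 2 x0; rewrite (_ : (3 `!)%:R = 6 :> R) //; lra.
Qed.

Lemma exprn_le_expR c n : 0 <= 1 - c -> (1 - c) ^+ n <= expR (- (c * n%:R)).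
Proof.
move=> c1; rewrite -mulNr expRM_natr; apply: lerXn2r; rewrite ?nnegrE ?expR_ge0 //.
exact: expR_ge1Dx.
Qed.

(** With [2 >= expR 2^-1], the cubic lower bound for [expR] beats [n ^ 2]; the 96 is 6 (from [3!])
    times 2 times [2 ^ 3]. *)
Lemma exp2_gt (c : R) : 0 < c ->
  exists N : nat, forall n t : nat, (N <= n)%N -> c * n%:R <= t%:R ->
    2 * n%:R ^+ 2 < 2 ^+ t :> R.
Proof.
move=> c0; pose N := (Num.bound (96 / c ^+ 3)).+1.
exists N => n t Nn ct.
have c30 : 0 < c ^+ 3 by rewrite exprn_gt0.
have n_gt : 96 / c ^+ 3 < n%:R.
  have h : 96 / c ^+ 3 < (Num.bound (96 / c ^+ 3))%:R by rewrite archi_boundP ?divr_ge0 ?ltW.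
  by apply: lt_le_trans h _; rewrite ler_nat ltnW.
have n0 : 0 < n%:R :> R by apply: le_lt_trans n_gt; rewrite divr_ge0 ?ltW.
have two : expR 2^-1 <= 2 :> R.
  have := expR_ge1Dx (- 2^-1 : R); rewrite expRN.
  rewrite -[X in _ <= X -> _]mul1r ler_pdivlMr ?expR_gt0 //; lra.
have le2 : expR (2^-1 * t%:R) <= 2 ^+ t :> R.
  by rewrite expRM_natr; apply: lerXn2r; rewrite ?nnegrE ?expR_ge0.
apply: lt_le_trans le2.
have t0 : 0 <= 2^-1 * t%:R :> R by rewrite mulr_ge0 ?invr_ge0.
have six : 0 < 6 :> R by rewrite ltr0n.
rewrite -(ltr_pM2l six); apply: le_lt_trans (cube_lt_expR t0).
have cn0 : 0 <= 2^-1 * (c * n%:R) by rewrite !mulr_ge0 ?invr_ge0 ?(ltW c0).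
apply: le_trans (_ : (2^-1 * (c * n%:R)) ^+ 3 <= _); last first.
  by apply: lerXn2r; rewrite ?nnegrE // ler_pM2l ?invr_gt0 ?ltr0n.
move: n_gt; rewrite ltr_pdivrMr // => n_gt.
rewrite (_ : 6 * _ = 8^-1 * (96 * n%:R ^+ 2)); last by field.
rewrite (_ : (_ * (c * _)) ^+ 3 = 8^-1 * ((n%:R * c ^+ 3) * n%:R ^+ 2)); last by field.
by rewrite ler_pM2l ?invr_gt0 ?ltr0n // ler_pM2r ?exprn_gt0 // ltW.
Qed.

Lemma exprn_decay c (theta : R) : 0 < c -> c <= 1 -> 0 < theta ->
  exists N : nat, forall l s : nat, (N <= l)%N -> theta * l%:R <= s%:R ->
    l%:R * (1 - c) ^+ s < 1 :> R.
Proof.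
move=> c0 c1 th0; pose u := c * theta; have u0 : 0 < u by rewrite mulr_gt0.
exists (Num.bound (6 / u ^+ 3)).+1 => l s Nl ths.
have u30 : 0 < u ^+ 3 by rewrite exprn_gt0.
have l_gt : 6 / u ^+ 3 < l%:R.
  have h : 6 / u ^+ 3 < (Num.bound (6 / u ^+ 3))%:R by rewrite archi_boundP ?divr_ge0 ?ltW.
  by apply: lt_le_trans h _; rewrite ler_nat ltnW.
have l1 : 1 <= l%:R :> R by rewrite ler1n; apply: leq_ltn_trans Nl.
have l0 : 0 < l%:R :> R by lra.
apply: le_lt_trans (_ : l%:R * expR (- (u * l%:R)) < _).
  apply: ler_wpM2l; first exact: ltW.
  apply: le_trans (exprn_le_expR _ _) _; first by lra.
  by rewrite ler_expR lerN2 /u -mulrA ler_pM2l.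
rewrite expRN ltr_pdivrMr ?expR_gt0 // mul1r.
have ul0 : 0 <= u * l%:R by rewrite mulr_ge0 ?ltW.
have six : 0 < 6 :> R by rewrite ltr0n.
rewrite -(ltr_pM2l six); apply: le_lt_trans (cube_lt_expR ul0).
move: l_gt; rewrite ltr_pdivrMr // => l_gt.
rewrite (_ : (u * _) ^+ 3 = (l%:R * u ^+ 3) * (l%:R * l%:R)); last by ring.
apply: ler_pM; rewrite ?ler0n ?(ltW l_gt) //.
by rewrite -[leLHS]mulr1 ler_pM2l.
Qed.

(** The base is at most [(1 - p) * (1 - eps / 4)], hence at most [expR (- (beta + eps / 4))], while
    [d] is at most [expR ((beta + eps / 8) * l ^ 2)]. The surplus [eps / 8 * l ^ 2] in the exponent
    absorbs the other factors, which are only [l ^ O(l)]. *)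
Lemma failure_bound (eps p K d : R) (l : nat) :
  0 < eps -> p < 1 - eps -> 0 < p -> (0 < l)%N -> 0 < d -> 1 <= K ->
  ln d <= (- ln (1 - p) + eps / 8) * l%:R ^+ 2 ->
  l%:R^-1 <= eps / 4 -> 32 * (K * l%:R) <= expR (eps / 8 * l%:R) ->
  16 * 2 ^+ l * (K * l%:R) ^+ l * (1 - p - eps / 2 + l%:R^-1) ^+ (l * l) * d <= 1.
Proof.
move=> eps0 p1 p0 l0 d0 K1 lnd linv Kl.
set beta := - ln (1 - p) in lnd *; set kap := _ + l%:R^-1.
have l1 : 1 <= l%:R :> R by rewrite ler1n.
have kap0 : 0 <= kap by rewrite addr_ge0 ?invr_ge0 //; lra.
have kap_le : kap <= expR (- (beta + eps / 4)).
  apply: le_trans (_ : (1 - p) * (1 - eps / 4) <= _).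
    have : 0 <= p * (eps / 4) by rewrite mulr_ge0 //; lra.
    by rewrite /kap; lra.
  rewrite opprD expRD; apply: ler_pM; [lra|lra| |exact: expR_ge1Dx].
  by rewrite /beta opprK lnK // posrE; lra.
have e1 : kap ^+ (l * l) * d <= expR (- (eps / 8) * l%:R ^+ 2).
  apply: le_trans (_ : expR (- (beta + eps / 4) * l%:R ^+ 2) *
                       expR ((beta + eps / 8) * l%:R ^+ 2) <= _).
    apply: ler_pM; [exact: exprn_ge0|exact: ltW| |].
      rewrite -natrX expRM_natr -mulnn; apply: lerXn2r; rewrite ?nnegrE ?expR_ge0 //.
    by rewrite -[leLHS](lnK d0) ler_expR.
  rewrite -expRD ler_expR -mulrDl; apply: ler_wpM2r; rewrite ?exprn_ge0 //; lra.
have e2 : 16 * 2 ^+ l * (K * l%:R) ^+ l <= expR (eps / 8 * l%:R ^+ 2).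
  apply: le_trans (_ : (32 * (K * l%:R)) ^+ l <= _).
    have -> : 32 = 16 * 2 :> R by ring.
    rewrite !exprMn.
    rewrite -!mulrA; apply: ler_wpM2r.
      by rewrite !mulr_ge0 ?exprn_ge0 //; lra.
    by rewrite -[leLHS]expr1; apply: ler_weXn2l => //; rewrite ler1n.
  rewrite expr2 [eps / 8 * _]mulrA expRM_natr; apply: lerXn2r; rewrite ?nnegrE ?expR_ge0 //.
  by rewrite mulr_ge0 // mulr_ge0 //; lra.
rewrite -mulrA; apply: le_trans (ler_pM _ _ e2 e1) _.
- by rewrite !mulr_ge0 ?exprn_ge0 ?mulr_ge0 //; lra.
- by rewrite mulr_ge0 ?exprn_ge0 // ltW.
- by rewrite -expRD -mulrDl addrN mul0r expR0.
Qed.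
Lemma exists_nat_gt (x : R) : exists N : nat, forall n, (N <= n)%N -> x < n%:R.
Proof.
exists (Num.bound `|x|) => n Nn; apply: le_lt_trans (ler_norm x) _.
by apply: lt_le_trans (archi_boundP (normr_ge0 x)) _; rewrite ler_nat.
Qed.

(** Half of the connectivity [k] serves as the degree [D] that bounds link lengths, the other half
    as room for [M] disjoint links. With [t] about [M / r], the failure term is at most
    [n ^ 2 * 2 ^ (- t)], and [t] is linear in [n]. *)
Lemma linking_parameters eps (q : R) : 0 < eps -> eps <= 1 -> 0 < q -> q <= 1 ->
  exists (i : nat) (c : R) (N : nat), [/\ 0 < c, c <= 1 &
    forall n k : nat, (N <= n)%N -> eps * n%:R <= k%:R ->
    exists D M t : nat, [/\ (D <= k)%N, (n < i.+1 * D)%N, (M * (3 * i + 1) <= k - D)%N,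
      n%:R ^+ 2 * (2 ^+ t * (1 - 2^-1 * q ^+ (3 * i + 1)) ^+ M) < 2^-1
      & c * n%:R <= t%:R]].
Proof.
move=> eps0 eps1 q0 q1.
have [i iP] := exists_nat_gt (2 / eps); have {}iP := iP i (leqnn i).
set L := (3 * i + 1)%N.
have L1 : 1 <= L%:R :> R by rewrite ler1n /L addn1.
set x := 2^-1 * q ^+ L.
have qL0 : 0 < q ^+ L by rewrite exprn_gt0.
have qL1 : q ^+ L <= 1 by rewrite exprn_ile1 ?(ltW q0).
have x0 : 0 < x by rewrite /x; lra.
have x1 : 0 <= 1 - x by rewrite /x; lra.
(* [r] is so large that [(1 - x) ^+ r] is at most a quarter: [expR (x * r)] exceeds 4 once [x * r]
   exceeds 3. *)
have [r rP] := exists_nat_gt (Num.max 1 (3 / x)); have {}rP := rP r (leqnn r).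
have r1 : 1 < r%:R :> R by apply: le_lt_trans rP; rewrite le_max lexx.
have rx : 3 < x * r%:R.
  by rewrite mulrC -ltr_pdivrMr //; apply: le_lt_trans rP; rewrite le_max lexx orbT.
have decay : 2 * (1 - x) ^+ r <= 2^-1.
  have := exprn_le_expR r x1; rewrite expRN.
  have E4 : 4 < expR (x * r%:R) by have := expR_ge1Dx (x * r%:R); lra.
  have : (expR (x * r%:R))^-1 <= 4^-1 by rewrite lef_pV2 ?posrE ?ltW //; lra.
  by lra.
pose c0 := eps / (4 * L%:R).
have c00 : 0 < c0 by rewrite divr_gt0 // mulr_gt0; lra.
have c01 : c0 <= 1 by rewrite ler_pdivrMr; lra.
pose c := c0 / (2 * r%:R).
have cr0 : 0 < 2 * r%:R :> R by lra.
have cP : 0 < c by rewrite divr_gt0.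
have [N1 N1P] := exp2_gt cP.
have [N2 N2P] := exists_nat_gt (6 * L%:R / eps).
have [N3 N3P] := exists_nat_gt (2 * r%:R / c0).
exists i, c, (N1 + N2 + N3).+1; split=> //; first by rewrite ler_pdivrMr //; lra.
move=> n k Nn kn.
have n1 : 1 <= n%:R :> R by rewrite ler1n; apply: leq_ltn_trans Nn.
have h2 := N2P n (leq_trans (leq_trans (leq_addl N1 N2) (leq_addr N3 _)) (ltnW Nn)).
have h3 := N3P n (leq_trans (leq_addl _ N3) (ltnW Nn)).
have Nn1 : (N1 <= n)%N by apply: leq_trans (ltnW Nn); rewrite -addnA leq_addr.
rewrite ltr_pdivrMr // in h2; rewrite ltr_pdivrMr // in h3.
exists (uphalf k), (k./2 %/ L)%N, (k./2 %/ L %/ r)%N.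
have kk : (uphalf k + k./2)%N = k by rewrite uphalf_half -addnA addnn odd_double_half.
have kD : (k - uphalf k)%N = k./2 by rewrite -{1}kk addKn.
have k2 : k%:R <= 2 * (uphalf k)%:R :> R.
  by rewrite -natrM ler_nat -{1}kk mul2n -addnn leq_add2l uphalf_half leq_addl.
have k3 : k%:R <= 2 * (k./2)%:R + 1 :> R.
  by rewrite -natrM natr1 ler_nat mul2n -{1}(odd_double_half k) -addn1 addnC leq_add2l leq_b1.
have M1 : (k./2)%:R <= ((k./2 %/ L)%N%:R + 1) * L%:R :> R.
  by rewrite natr1 -natrM ler_nat ltnW // ltn_ceil // /L addn1.
have r0 : (0 < r)%N by rewrite -(ltr0n R); lra.
have t1 : (k./2 %/ L)%N%:R <= ((k./2 %/ L %/ r)%N%:R + 1) * r%:R :> R.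
  by rewrite natr1 -natrM ler_nat ltnW // ltn_ceil.
have MrT : (r * (k./2 %/ L %/ r) <= k./2 %/ L)%N by rewrite mulnC leq_trunc_div.
have ML : (k./2 %/ L * L <= k./2)%N by exact: leq_trunc_div.
set M := (k./2 %/ L)%N in M1 t1 MrT ML *; set t := (M %/ r)%N in t1 MrT *.
have LR0 : 0 < L%:R :> R by lra.
have Mc : c0 * n%:R <= M%:R.
  rewrite /c0 -mulrA mulrC -mulrA mulrC ler_pdivrMr ?mulr_gt0 //.
  by rewrite mulrC; move: kn k3 M1 h2 L1; rewrite mulrDl mul1r; lra.
have ct : c * n%:R <= t%:R.
  rewrite /c mulrAC ler_pdivrMr //; move: Mc t1 h3; rewrite mulrDl mul1r; lra.
split=> //.
- by rewrite -{2}kk leq_addr.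
- rewrite -(ltr_nat R) natrM.
  have u0 : 0 < (uphalf k)%:R :> R.
    have : 0 < eps * n%:R by rewrite mulr_gt0 //; lra.
    by lra.
  have : n%:R <= 2 / eps * (uphalf k)%:R :> R.
    by rewrite mulrAC ler_pdivlMr // mulrC; lra.
  have : 2 / eps * (uphalf k)%:R < i.+1%:R * (uphalf k)%:R :> R.
    by rewrite ltr_pM2r //; apply: lt_trans iP _; rewrite ltr_nat.
  by lra.
- by rewrite kD.
have big := N1P n t Nn1 ct.
have le : (1 - x) ^+ M <= (1 - x) ^+ (r * t).
  have x2 : 1 - x <= 1 by lra.
  exact: ler_wiXn2l x1 x2 _ _ MrT.
have half : 2 ^+ t * (1 - x) ^+ (r * t) <= 2^-1 ^+ t.
  by rewrite exprM -exprMn; apply: lerXn2r; rewrite ?nnegrE ?mulr_ge0 ?exprn_ge0 ?invr_ge0.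
have two0 : 0 < 2 ^+ t :> R by rewrite exprn_gt0.
have : 2 ^+ t * (1 - x) ^+ M <= 2^-1 ^+ t.
  by apply: le_trans half; rewrite ler_pM2l.
move=> le2; apply: le_lt_trans (_ : n%:R ^+ 2 * 2^-1 ^+ t < _).
  by apply: ler_wpM2l; rewrite ?exprn_ge0.
by rewrite exprVn ltr_pdivrMr //; lra.
Qed.

End Estimates.

(** * Hypotheses in numerical form and the inequalities between the parameters *)

Lemma density_edges (R : realType) (G : sgraph) (x : R) : (2 <= #|G|)%N ->
  x <= density G -> x * (#|G|%:R * (#|G|%:R - 1)) <= 2 * #|edges G|%:R.
Proof.
move=> G2; have C0 : 0 < 'C(#|G|, 2)%:R :> R by rewrite ltr0n bin_gt0.
rewrite /density ler_pdivlMr // => le.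
have -> : #|G|%:R * (#|G|%:R - 1) = 2 * 'C(#|G|, 2)%:R :> R.
  have -> : #|G|%:R - 1 = #|G|.-1%:R :> R by rewrite -subn1 natrB // ltnW.
  by rewrite -!natrM [(2 * _)%N]mulnC bin_ffact ffactnS ffactn1.
by rewrite mulrCA ler_pM2l.
Qed.

Lemma avg_degree_le (R : realType) (H : sgraph) : avg_degree H <= #|H|%:R :> R.
Proof.
rewrite /avg_degree -card_adj; have [->|H0] := posnP #|H|; first by rewrite invr0 mulr0.
rewrite ler_pdivrMr ?ltr0n // -natrM ler_nat -card_prod; exact: max_card.
Qed.

Lemma large_part_sizes (R : realType) (eps K c theta : R) (L : nat) :
  0 < eps -> 0 < c -> c <= 1 -> 0 < theta ->
  exists N : nat, forall l : nat, (N <= l)%N ->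
    [/\ (0 < l)%N, l%:R^-1 <= eps / 4, 32 * (K * l%:R) <= expR (eps / 8 * l%:R),
        l%:R * (1 - c / 2) ^+ Num.trunc (theta * l%:R) < 1 &
        16 * L%:R <= c * l%:R].
Proof.
move=> eps0 c0 c1 th0.
have c20 : 0 < c / 2 by lra.
have c21 : c / 2 <= 1 by lra.
have th20 : 0 < theta / 2 by lra.
have [N1 N1P] := exprn_decay c20 c21 th20.
have [N2 N2P] := exists_nat_gt (4 / eps).
have e80 : 0 < (eps / 8) ^+ 3 by rewrite exprn_gt0 // divr_gt0.
(* 192 is 32 times the 6 of [cube_lt_expR]. *)
have [N3 N3P] := exists_nat_gt (192 * K / (eps / 8) ^+ 3).
have [N4 N4P] := exists_nat_gt (2 / theta).
have [N5 N5P] := exists_nat_gt (16 * L%:R / c).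
exists (N1 + (N2 + (N3 + (N4 + N5))) + 1)%N => l Nl.
have l0 : (0 < l)%N by move: Nl; clear; lia.
have l1 : 1 <= l%:R :> R by rewrite ler1n.
have lR0 : 0 < l%:R :> R by lra.
have {}N2P : 4 / eps < l%:R by apply: N2P; move: Nl; clear; lia.
have {}N3P : 192 * K / (eps / 8) ^+ 3 < l%:R by apply: N3P; move: Nl; clear; lia.
have {}N4P : 2 / theta < l%:R by apply: N4P; move: Nl; clear; lia.
have {}N5P : 16 * L%:R / c < l%:R by apply: N5P; move: Nl; clear; lia.
split=> //.
- rewrite -[leLHS]mul1r ler_pdivrMr // mulrAC ler_pdivlMr // mul1r.
  by move: N2P; rewrite ltr_pdivrMr // mulrC => /ltW.
- have el0 : 0 <= eps / 8 * l%:R by rewrite mulr_ge0 ?divr_ge0 ?(ltW eps0).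
  have := cube_lt_expR el0; move: N3P; rewrite ltr_pdivrMr // => N3P cube.
  have : 192 * K * l%:R <= l%:R * (eps / 8) ^+ 3 * l%:R by rewrite ler_pM2r // ltW.
  have : l%:R * (eps / 8) ^+ 3 * l%:R <= (eps / 8 * l%:R) ^+ 3.
    rewrite (_ : (_ * l%:R) ^+ 3 = l%:R * (eps / 8) ^+ 3 * l%:R * l%:R); last by ring.
    have le0 : 0 < l%:R * (eps / 8) ^+ 3 * l%:R by do 2 apply: mulr_gt0 => //.
    by rewrite -[leLHS]mulr1 ler_pM2l.
  by move: cube; lra.
- have tl0 : 0 <= theta * l%:R by apply: mulr_ge0 => //; apply: ltW.
  apply: N1P; first by move: Nl; clear; lia.
  have /andP[_] := truncn_itv tl0; rewrite -natr1.
  move: N4P; rewrite ltr_pdivrMr // [_ * theta]mulrC; lra.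
- by move: N5P; rewrite ltr_pdivrMr // [_ * c]mulrC => /ltW.
Qed.

(** Replacing [lam] by [l] costs a relative loss of about [10 * a], that is about [10 * a * beta];
    this is below [eps / 8] because [a * Lam] is small against [eps]. *)
Lemma log_degree_bound (R : realFieldType) (a eps lam Lam beta l : R) :
  0 < a -> 320 * a <= 1 -> 160 * a <= eps ->
  160 * a * Lam <= eps -> 0 <= beta -> beta <= Lam -> 0 <= lam ->
  (1 - 5 * a) * lam <= l ->
  beta * lam ^+ 2 <= (beta + eps / 8) * l ^+ 2.
Proof.
move=> a0 a1 aeps aLam beta0 betaLam lam0 l5.
apply: le_trans (_ : (beta + eps / 8) * ((1 - 5 * a) * lam) ^+ 2 <= _).
  have -> : (beta + eps / 8) * ((1 - 5 * a) * lam) ^+ 2 =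
      (beta + eps / 8) * (1 - 5 * a) ^+ 2 * lam ^+ 2 by ring.
  apply: ler_wpM2r; first exact: exprn_ge0.
  have h1 : a * beta <= a * Lam by rewrite ler_pM2l.
  have eps0 : 0 < eps by lra.
  have h2 : 320 * a * eps <= 1 * eps by rewrite ler_pM2r.
  have h3 : 0 <= (beta + eps / 8) * a ^+ 2 by apply: mulr_ge0; [lra | apply/exprn_ge0/ltW].
  by rewrite expr2 in h3 *; move: h1 h2 h3 aLam a0 aeps; clear; lra.
apply: ler_wpM2l; first by lra.
have h1 : 0 <= (1 - 5 * a) * lam by apply: mulr_ge0 => //; lra.
by apply: lerXn2r; rewrite ?nnegrE //; apply: le_trans h1 l5.
Qed.

(** [S] is the number of vertices in the blocks. The factor [1 - 4 * a] in [l] leaves room for the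
    reserve, for rounding [m] down and for discarding unbalanced parts, each costing about [a]. *)
Lemma part_count_bound (R : realFieldType) (a lam h n l S : R) :
  0 < a -> 320 * a <= 1 ->
  0 <= lam -> 1 <= a * h -> 0 <= h -> 0 <= l -> l <= (1 - 4 * a) * lam ->
  h * lam <= n -> (1 - a) * n < S + l -> h * l <= S * (1 - a).
Proof.
move=> a0 a1 lam0 ah h0 l0 l_le hn S_gt.
have b1 : h * l <= h * ((1 - 4 * a) * lam) by apply: ler_wpM2l.
have b2 : (1 - 2 * a) * (h * lam) <= (1 - 2 * a) * n by apply: ler_wpM2l => //; lra.
have b3 : (1 - a) * ((1 - a) * n) <= (1 - a) * (S + l).
  by apply: ler_wpM2l; [lra | exact: ltW].
have b4 : 0 <= a * l by apply: mulr_ge0 => //; exact: ltW.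
have b5 : 0 <= a * a * n.
  by apply: mulr_ge0; [apply: mulr_ge0; exact: ltW | apply: le_trans hn; apply: mulr_ge0].
have b6 : lam <= a * h * lam by rewrite -[leLHS]mul1r; apply: ler_wpM2r.
have b7 : 0 <= a * lam by apply: mulr_ge0 => //; exact: ltW.
by move: b1 b2 b3 b4 b5 b6 b7 l_le lam0; clear; lra.
Qed.

(** Dropping the vertices outside the blocks affects at most [4 * a * n ^ 2] ordered pairs, which
    half of the excess density [eps] pays for. *)
Lemma sparsity_bound (R : realFieldType) (a eps p n S e : R) :
  0 < a -> 160 * a <= eps ->
  0 < p -> p + eps < 1 -> 0 < n -> 4 <= eps * n -> 0 <= S -> S <= n ->
  (1 - 2 * a) * n <= S -> (p + eps) * (n * (n - 1)) <= 2 * e ->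
  S ^+ 2 + 2 * (n * (n - S)) - 2 * e <= S ^+ 2 * (1 - p - eps / 2).
Proof.
move=> a0 aeps p0 p1 n0 n4 S0 Sn S_ge edges.
have S2 : S ^+ 2 <= n ^+ 2 by apply: lerXn2r; rewrite ?nnegrE // ltW.
have b1 : S ^+ 2 * (p + eps / 2) <= n ^+ 2 * (p + eps / 2) by apply: ler_wpM2r => //; lra.
have b2 : n * (n - S) <= n * (2 * a * n) by rewrite ler_pM2l //; lra.
have b3 : (p + eps) * n <= 1 * n by rewrite ler_pM2r // ltW.
have b4 : 4 * n <= eps * n * n by rewrite ler_pM2r.
have b5 : 160 * a * (n * n) <= eps * (n * n) by rewrite ler_pM2r // mulr_gt0.
by rewrite !expr2 in b1 *; move: edges b1 b2 b3 b4 b5 n0; clear; lra.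
Qed.

(** Both [s * (L + 1)] and [L] are at most [c * l / 16], so [h] requests use at most [c * n / 8]
    vertices. *)
Lemma request_bound (R : realFieldType) (c L h l n s t : R) :
  0 < c -> 0 <= L -> 0 <= h -> 0 <= l -> h * l <= n -> s * (16 * (L + 1)) <= c * l ->
  16 * L <= c * l -> 2 <= c * n -> c * n <= 2 * t + 1 ->
  h * (s + s * L + L) <= t.
Proof.
move=> c0 L0 h0 l0 hln sl Ll cn2 ct.
have b4 : h * (s + s * L + L) <= h * (c / 8 * l) by apply: ler_wpM2l => //; lra.
have b5 : c * (h * l) <= c * n by rewrite ler_pM2l.
by move: b4 b5 cn2 ct; clear; lra.
Qed.

(** Here [q = a / 2] gives a reserve of at most [a * n] vertices, [K = 2 / a] makes at most a
    fraction [a] of the parts unbalanced, and [s] is the floor of [theta * l], a small multiple of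
    [l]. *)
Lemma minor_of_large_parts (R : realType) (eps a c p d lam : R) (N0 N1 i : nat)
    (G H : sgraph) :
  let L := (3 * i + 1)%N in let K := 2 / a in
  let theta := c / (16 * (L%:R + 1)) in
  0 < a -> 320 * a <= 1 -> 160 * a <= eps -> 160 * a * - ln eps <= eps -> eps <= 1 ->
  0 < c -> c <= 1 ->
  (forall n k : nat, (N0 <= n)%N -> eps * n%:R <= k%:R ->
    exists D M t : nat, [/\ (D <= k)%N, (n < i.+1 * D)%N, (M * L <= k - D)%N,
      n%:R ^+ 2 * (2 ^+ t * (1 - 2^-1 * (a / 2) ^+ L) ^+ M) < 2^-1
      & c * n%:R <= t%:R]) ->
  (forall l : nat, (N1 <= l)%N ->
    [/\ (0 < l)%N, l%:R^-1 <= eps / 4, 32 * (K * l%:R) <= expR (eps / 8 * l%:R),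
        l%:R * (1 - c / 2) ^+ Num.trunc (theta * l%:R) < 1 &
        16 * L%:R <= c * l%:R]) ->
  d = avg_degree H -> 0 < d -> eps < p -> p < 1 - eps -> p + eps <= density G ->
  #|H|%:R * lam <= #|G|%:R -> eps * #|G|%:R <= (kappa G)%:R ->
  - ln (1 - p) * lam ^+ 2 = ln d -> 2 * N1%:R + 2 <= lam -> 1 <= a * lam ->
  a^-1 + 4 <= #|H|%:R -> N0%:R <= #|G|%:R :> R -> 4 / eps <= #|G|%:R ->
  2 / c <= #|G|%:R ->
  minor G H.
Proof.
move=> L K theta a0 a1 aeps aLam eps1 c0 c1 linkP sizeP dE d0 p1 p2 denG HG kapG
  lamlnd lamN1 alam hR N0n n4' cn2'.
have eps0 : 0 < eps by move: a0 aeps; clear; lra.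
have p0 : 0 < p by exact: lt_trans p1.
have pe : p + eps < 1 by move: p2; clear; lra.
pose beta := - ln (1 - p); rewrite -/beta in lamlnd.
have omp0 : 0 < 1 - p by move: p2 eps0; clear; lra.
have betaLam : beta <= - ln eps.
  by rewrite lerN2 ler_ln ?posrE //; move: p2; clear; lra.
have beta0 : 0 <= beta.
  by rewrite oppr_ge0; apply: ln_le0; move: p0; clear; lra.
have L0 : 0 <= L%:R :> R by [].
have thE : theta * (16 * (L%:R + 1)) = c.
  by rewrite /theta divfK // gt_eqF //; move: L0; clear; lra.
have th0 : 0 < theta by rewrite divr_gt0 //; move: L0; clear; lra.
have lam2 : 2 <= lam.
  by apply: le_trans lamN1; have : 0 <= N1%:R :> R by []; clear; lra.
have lam0 : 0 <= lam by apply: le_trans lam2.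
have sz0 : 0 <= (1 - 4 * a) * lam.
  by apply: mulr_ge0 => //; move: a1 a0; clear; lra.
pose l := Num.trunc ((1 - 4 * a) * lam).
have [l_le l_gt] : l%:R <= (1 - 4 * a) * lam /\ (1 - 4 * a) * lam < l%:R + 1.
  by apply/andP; rewrite natr1; apply: truncn_itv.
have a8lam : 320 * a * lam <= 1 * lam by apply: ler_wpM2r.
have alam0 : 0 <= a * lam by apply: mulr_ge0 => //; exact: ltW.
have lN1 : (N1 <= l)%N.
  by rewrite -(ler_nat R); move: lamN1 l_gt a8lam (ler0n R N1); clear; lra.
have l_le_lam : l%:R <= lam by move: l_le alam0; clear; lra.
have [l0 linv Kl decay Ll] := sizeP l lN1.
clearbody l.
have lR0 : 0 < l%:R :> R by rewrite ltr0n.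
set h := #|H| in HG hR; set n := #|G| in HG kapG N0n n4' cn2'.
have aV0 : 0 < a^-1 by rewrite invr_gt0.
have h4 : 4 <= h%:R :> R by move: hR aV0; clear; lra.
have h0 : 0 < h%:R :> R by move: h4; clear; lra.
have ah : 1 <= a * h%:R.
  by rewrite -ler_pdivrMl // mulr1; move: hR; clear; lra.
have n_ge : h%:R <= n%:R :> R.
  by apply: le_trans HG; rewrite -[leLHS]mulr1 ler_pM2l //; move: lam2; clear; lra.
have n0 : 0 < n%:R :> R by apply: lt_le_trans n_ge.
have n4 : 4 <= eps * n%:R by rewrite mulrC -ler_pdivrMr.
have cn2 : 2 <= c * n%:R by rewrite mulrC -ler_pdivrMr.
have lan : l%:R <= a * n%:R.
  apply: le_trans l_le_lam _; apply: le_trans (_ : a * (h%:R * lam) <= _).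
    by rewrite mulrA -[leLHS]mul1r; apply: ler_wpM2r.
  by rewrite ler_pM2l.
have lnd_le : ln d <= (beta + eps / 8) * l%:R ^+ 2.
  rewrite -lamlnd; apply: (log_degree_bound a0 a1 aeps aLam) => //.
  by move: l_gt alam; clear; lra.
(* As many transversals of size [l] as fit outside the reserve. *)
pose m := Num.trunc ((1 - a) * n%:R / l%:R).
have oma0 : 0 <= 1 - a by move: a1 a0; clear; lra.
have m_arg0 : 0 <= (1 - a) * n%:R / l%:R.
  by apply: divr_ge0 => //; apply: mulr_ge0.
have [m_le m_gt] : m%:R * l%:R <= (1 - a) * n%:R /\ (1 - a) * n%:R < m%:R * l%:R + l%:R.
  apply/andP; have := truncn_itv m_arg0; rewrite -/m -natr1.
  by rewrite ler_pdivlMr // ltr_pdivrMr // [(_ + 1) * _]mulrDl mul1r.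
clearbody m.
have lmE : (l * m)%:R = m%:R * l%:R :> R by rewrite mulnC natrM.
have KE : 2 / K = a by rewrite /K invf_div mulrC divfK // pnatr_eq0.
have hm : h%:R <= m%:R * (1 - 2 / K).
  rewrite KE -(ler_pM2r lR0) mulrAC.
  exact: part_count_bound a0 a1 lam0 ah (ltW h0) (ltW lR0) l_le HG m_gt.
have m4 : (4 <= m)%N.
  rewrite -(ler_nat R); apply: le_trans h4 (le_trans hm _).
  by rewrite KE -[leRHS]mulr1 ler_wpM2l //; move: a0; clear; lra.
have n2 : (2 <= #|G|)%N.
  by rewrite -(ler_nat R) -/n; move: h4 n_ge; clear; lra.
have edgesG := density_edges n2 denG; rewrite -/n in edgesG.
have kG := kappa_connected (ltnW n2).
have N0n' : (N0 <= n)%N by rewrite -(ler_nat R).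
have [D [M [t [Dk big Mk small ct]]]] := linkP n (kappa G) N0n' kapG.
(* The budget [t] is halved: [t./2] vertices may be used up, and [uphalf t] neighbours stay
   available for domination. *)
have t_split : (t./2 + uphalf t)%N = t by rewrite uphalf_half addnCA addnn odd_double_half.
have t_half : t%:R <= 2 * (uphalf t)%:R :> R.
  by rewrite -natrM ler_nat -{1}t_split mul2n -addnn leq_add2r uphalf_half leq_addl.
have t_half' : t%:R <= 2 * (t./2)%:R + 1 :> R.
  rewrite -natrM natr1 ler_nat mul2n -{1}(odd_double_half t) -addn1 addnC leq_add2l.
  exact: leq_b1.
have tsub : (t - t./2)%N = uphalf t by rewrite -{1}t_split addKn.
have [s_le _] := andP (truncn_itv (mulr_ge0 (ltW th0) (ltW lR0))).
have Sn : m%:R * l%:R <= n%:R :> R.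
  by apply: le_trans m_le _; rewrite -[leRHS]mul1r ler_pM2r //; move: a0; clear; lra.
have q0 : 0 < a / 2 by move: a0; clear; lra.
have q1 : a / 2 <= 1 by move: a1 a0; clear; lra.
apply: (minor_of_parameters (k0 := 1 - p - eps / 2) (K := K) (c := c / 2) (q := a / 2)
  (t' := t./2) (s := Num.trunc (theta * l%:R)) (l := l) (m := m) kG Dk big Mk q0 q1 small) => //.
- by rewrite -subn_gt0 tsub -(ltr0n R); move: t_half ct cn2; clear; lra.
- by move: c0; clear; lra.
- by move: c1 c0; clear; lra.
- by rewrite tsub; move: t_half ct; clear; lra.
- by rewrite lmE -/n; move: m_le; clear; lra.
- rewrite lmE -/n; apply: (sparsity_bound a0 aeps) => //.
    by apply: mulr_ge0.
  by move: m_gt lan; clear; lra.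
- by rewrite /K ler_pdivlMr //; move: a1 a0; clear; lra.
- have K1 : 1 <= K by rewrite /K ler_pdivlMr //; move: a1 a0; clear; lra.
  have fb := failure_bound eps0 p2 p0 l0 d0 K1 lnd_le linv Kl.
  have eH : (2 * #|edges H|)%:R = d * h%:R :> R by rewrite dE /avg_degree divfK // gt_eqF.
  by rewrite eH mulrA -/h -[leRHS]mul1r ler_pM2r.
- rewrite -(ler_nat R) -/h -/L natrM 2!natrD natrM.
  apply: (request_bound c0 L0 (ltW h0) (ltW lR0) (n := n%:R)) => //.
  + by apply: le_trans HG; rewrite ler_pM2l.
  + apply: le_trans (_ : theta * l%:R * (16 * (L%:R + 1)) <= _); last by rewrite mulrAC thE.
    by apply: ler_wpM2r s_le; move: L0; clear; lra.
  + exact: le_trans ct t_half'.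
Qed.

Theorem theorem1p6 (R : realType) (eps : R) (heps : 0 < eps) :
  exists D1 : R,
    forall (H G : sgraph) (d p : R),
      d = avg_degree H ->
      D1 < d ->
      eps < p ->
      p < 1 - eps ->
      p + eps <= density G ->
      #|H|%:R * Num.sqrt (logb (1 / (1 - p)) d) <= #|G|%:R ->
      eps * #|G|%:R <= (kappa G)%:R ->
      minor G H.
Proof.
(* For [eps >= 1/2] no [p] satisfies the bounds; below that [- ln eps] is positive and bounds
   [- ln (1 - p)], as [1 - p > eps]. *)
have [eps2|eps2] := ltrP eps (2^-1); last first.
  by exists 0 => H G d p _ _ p1 p2; exfalso; move: eps2 p1 p2; clear; lra.
set Lam := - ln eps.
have Lam0 : 0 < Lam.
  by rewrite oppr_gt0 ln_lt0 // heps; move: eps2; clear; lra.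
have Lam1 : 0 < Lam + 1 by move: Lam0; clear; lra.
(* Small enough for both [160 * a] and [160 * a * Lam] to be at most [eps]. *)
pose a := eps / (160 * (Lam + 1)).
have aE : 160 * a * (Lam + 1) = eps.
  by rewrite /a; field; rewrite gt_eqF.
have a0 : 0 < a by rewrite divr_gt0 // mulr_gt0.
clearbody a.
have aL0 : 0 < a * Lam by apply: mulr_gt0.
have aLam : 160 * a * Lam <= eps by move: aE a0; clear; lra.
have aeps : 160 * a <= eps by move: aE aL0; clear; lra.
have a1 : 320 * a <= 1 by move: aeps eps2; clear; lra.
have eps1 : eps <= 1 by move: eps2; clear; lra.
have q0 : 0 < a / 2 by move: a0; clear; lra.
have q1 : a / 2 <= 1 by move: a1 a0; clear; lra.
have [i [c [N0 [c0 c1 linkP]]]] := linking_parameters heps eps1 q0 q1.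
set L := (3 * i + 1)%N in linkP.
pose theta := c / (16 * (L%:R + 1)).
have th0 : 0 < theta by rewrite divr_gt0 //; move: (ler0n R L); clear; lra.
have [N1 N1P] := large_part_sizes (2 / a) L heps c0 c1 th0.
have aV0 : 0 < a^-1 by rewrite invr_gt0.
pose lam0 := 2 * N1%:R + 2 + a^-1.
have N10 : 0 <= N1%:R :> R by [].
have lam00 : 0 < lam0 by rewrite /lam0; move: N10 aV0; clear; lra.
have cV0 : 0 < 2 / c by rewrite divr_gt0.
have epsV0 : 0 < 4 / eps by rewrite divr_gt0.
(* The exponential forces [ln d > Lam * lam0 ^ 2], hence [lam >= lam0]. The other summands are the
   thresholds for [#|H|] and [#|G|], both at least [d] since the average degree is at most [#|H|]
   and [lam >= 1]. *)
exists (N0%:R + 2 / c + 4 / eps + a^-1 + 4 + expR (Lam * lam0 ^+ 2)) => H G d p dE.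
have E0 : 0 < expR (Lam * lam0 ^+ 2) by rewrite expR_gt0.
have N00 : 0 <= N0%:R :> R by [].
move=> D1d p1 p2 denG HG kapG.
have dH : d <= #|H|%:R by rewrite dE avg_degree_le.
pose beta := - ln (1 - p).
have omp : 0 < 1 - p by move: p2 heps; clear; lra.
have betaLam : beta <= Lam.
  by rewrite lerN2 ler_ln ?posrE //; move: p2; clear; lra.
have beta0 : 0 < beta.
  by rewrite oppr_gt0 ln_lt0 // omp; move: p1 heps; clear; lra.
have Ed : expR (Lam * lam0 ^+ 2) < d.
  by move: D1d N00 cV0 epsV0 aV0; clear; lra.
have d0 : 0 < d by apply: lt_trans Ed.
have logE : logb (1 / (1 - p)) d = ln d / beta by rewrite /logb div1r lnV // posrE.
rewrite logE in HG; set lam := Num.sqrt (ln d / beta) in HG.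
have lnd : Lam * lam0 ^+ 2 < ln d by rewrite -[ltLHS]expRK ltr_ln ?posrE.
have lnd0 : 0 < ln d by apply: lt_trans lnd; rewrite mulr_gt0 ?exprn_gt0.
have lamlnd : beta * lam ^+ 2 = ln d.
  by rewrite sqr_sqrtr ?divr_ge0 ?ltW // mulrC divfK // gt_eqF.
have lam_ge : lam0 <= lam.
  rewrite -(@ler_pXn2r _ 2) ?nnegrE ?sqrtr_ge0 ?(ltW lam00) //.
  rewrite -(ler_pM2l beta0) lamlnd; apply: le_trans (ltW lnd).
  by rewrite ler_pM2r ?exprn_gt0.
have lam1 : 1 <= lam by move: lam_ge; rewrite /lam0; move: N10 aV0; clear; lra.
have HG' : #|H|%:R <= #|G|%:R :> R.
  by apply: le_trans HG; rewrite -[leLHS]mulr1; apply: ler_wpM2l.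
have dG := le_trans dH HG'.
apply: (minor_of_large_parts (lam := lam) a0 a1 aeps aLam eps1 c0 c1 linkP N1P dE d0
  p1 p2 denG HG kapG lamlnd).
- by apply: le_trans lam_ge; rewrite /lam0; move: aV0; clear; lra.
- rewrite -ler_pdivrMl // mulr1; apply: le_trans lam_ge.
  by rewrite /lam0; move: N10; clear; lra.
- by apply: le_trans dH; move: D1d N00 cV0 epsV0 E0; clear; lra.
- by apply: le_trans dG; move: D1d aV0 cV0 epsV0 E0; clear; lra.
- by apply: le_trans dG; move: D1d N00 aV0 cV0 E0; clear; lra.
- by apply: le_trans dG; move: D1d N00 aV0 epsV0 E0; clear; lra.
Qed.
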